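(* All Pearson diffusion processes, i.e. all diffusion processes whose drift function $\mu(x)$ and variance function $\frac12\sigma^2(x)$ are polynomials of degrees at most one and two, respectively, are optimal in terms of the convergence rate $\lambda_1$. In particular, all Pearson diffusion processes of the hypergeometric type (those whose eigenfunctions are written in terms of hypergeometric or confluent hypergeometric functions), with polynomials of degree at most two as variance functions, are optimal.
   Context: A diffusion process is a time-homogeneous process $dX(t)=\mu(X(t))\,dt+\sigma(X(t))\,dW(t)$ on $(x_1,x_2)$, $-\infty\le x_1<x_2\le\infty$, where $W$ is a Brownian motion, with reflecting boundary conditions. It is assumed to be strictly stationary and ergodic with stationary density $\pi$, and reversible with respect to $\pi$ (detailed balance), so that $\mu(x)=\frac{1}{2\pi(x)}\frac{d}{dx}\bigl(\sigma^2(x)\pi(x)\bigr)$; this is called the Pearson equation when $\mu$ and $\frac12\sigma^2$ are polynomials of degrees at most one and two. The function $\frac12\sigma^2$ is the variance function, and its average variance is $\frac12\widehat{\sigma}^2=\int_{x_1}^{x_2}\frac12\sigma^2(x)\pi(x)\,dx$. The convergence rate $\lambda_1$ is the first discrete eigenvalue other than $\lambda_0=0$ (assumed to exist) of the Sturm-Liouville problem $$\frac12\frac{d}{dx}\left(\pi(x)\sigma^2(x)\frac{d}{dx}\phi(x)\right)+\lambda\,\pi(x)\phi(x)=0,\qquad \frac12\sigma^2(x)\pi(x)\frac{d}{dx}\phi(x)=0\ \text{ at } x=x_1,x_2.$$ A diffusion process with stationary density $\pi$ and average variance $\frac12\widehat{\sigma}^2$ is optimal if its $\lambda_1$ is the maximum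 over all variance functions with the same average variance $\frac12\widehat{\sigma}^2$, for the same stationary density $\pi$.
   Formalization: The variance polynomial is required to vanish at each finite end of the state space; without this the claim fails, e.g. for Brownian motion reflected at 0 and 1 (rate about 9.87 times the average variance, against 12 for the variance function proportional to x(1-x)). *)

(* Defs.v *)
From HB Require Import structures.
From mathcomp Require Import all_boot all_order all_algebra.
From mathcomp Require Import all_classical all_reals all_analysis.

Set Implicit Arguments.
Unset Strict Implicit.
Unset Printing Implicit Defensive.

Import Order.TTheory GRing.Theory Num.Theory.
Import numFieldNormedType.Exports.

Local Open Scope classical_set_scope.
Local Open Scope ring_scope.

Section Diffusions.
Context {R : realType}.
Implicit Types (pi mu sigma u h g phi : R -> R) (lam : R).

Notation leb := (@lebesgue_measure R).

Definition state_space (x1 x2 : \bar R) : set R :=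
  [set x | (x1 < x%:E)%E /\ (x%:E < x2)%E].

(* [F @ lower_end x1 --> l] is the limit of F at the end x1 of the state space,
   taken from inside; likewise for [upper_end]. *)
Definition lower_end (x1 : \bar R) : set_system R :=
  if x1 is a%:E then a^'+ else -oo.
Definition upper_end (x2 : \bar R) : set_system R :=
  if x2 is b%:E then b^'- else +oo.

Definition variance_function sigma (x : R) : R := 2^-1 * sigma x ^+ 2.

Definition average_variance (x1 x2 : \bar R) pi sigma : R :=
  \int[leb]_(x in state_space x1 x2) (variance_function sigma x * pi x).

(* The process dX = mu(X) dt + sigma(X) dW on (x1, x2), reflected at the ends,
   is represented by its coefficients; reversibility with respect to pi is the
   detailed balance relation [rd_balance].  Positivity of pi and sigma^2 on the
   open interval makes pi the unique stationary density (ergodicity). *)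
Record reversible_diffusion (x1 x2 : \bar R) pi mu sigma : Prop :=
  ReversibleDiffusion {
  rd_interval : (x1 < x2)%E ;
  rd_density_gt0 : forall x, state_space x1 x2 x -> 0 < pi x ;
  rd_density_continuous : forall x, state_space x1 x2 x ->
    {for x, continuous pi} ;
  rd_density_mass : (\int[leb]_(x in state_space x1 x2) (pi x)%:E = 1)%E ;
  rd_sigma_neq0 : forall x, state_space x1 x2 x -> sigma x != 0 ;
  rd_variance_continuous : forall x, state_space x1 x2 x ->
    {for x, continuous (variance_function sigma)} ;
  rd_average_finite : leb.-integrable (state_space x1 x2)
    (fun x => (variance_function sigma x * pi x)%:E) ;
  rd_derivable : forall x, state_space x1 x2 x ->
    derivable (fun y => sigma y ^+ 2 * pi y) x 1 ;
  rd_balance : forall x, state_space x1 x2 x ->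
    mu x = (2 * pi x)^-1 * derive1 (fun y => sigma y ^+ 2 * pi y) x
}.

Definition square_integrable (x1 x2 : \bar R) pi g : Prop :=
  measurable_fun (state_space x1 x2) g /\
  leb.-integrable (state_space x1 x2) (fun x => (g x ^+ 2 * pi x)%:E).

Definition norm2_sq (x1 x2 : \bar R) pi g : R :=
  \int[leb]_(x in state_space x1 x2) (g x ^+ 2 * pi x).

Definition flux pi sigma phi (x : R) : R :=
  2^-1 * sigma x ^+ 2 * pi x * derive1 phi x.

Definition reflecting (x1 x2 : \bar R) pi sigma phi : Prop :=
  flux pi sigma phi x @[x --> lower_end x1] --> 0 /\
  flux pi sigma phi x @[x --> upper_end x2] --> 0.

(* Eigenfunctions are taken in L^2(pi): when an end is infinite and the tails
   of pi are heavy, the reflecting condition alone does not select them. *)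
Definition eigenfunction (x1 x2 : \bar R) pi sigma lam phi : Prop :=
  [/\ square_integrable x1 x2 pi phi,
      exists2 x, state_space x1 x2 x & phi x != 0,
      forall x, state_space x1 x2 x -> derivable phi x 1,
      forall x, state_space x1 x2 x ->
        derivable (flux pi sigma phi) x 1 /\
        derive1 (flux pi sigma phi) x + lam * pi x * phi x = 0 &
      reflecting x1 x2 pi sigma phi].

Definition eigenvalue (x1 x2 : \bar R) pi sigma lam : Prop :=
  exists phi, eigenfunction x1 x2 pi sigma lam phi.

(* The graph of the self-adjoint Sturm-Liouville operator in L^2(pi):
   u is in the domain and  h = - (1/pi) d/dx (1/2 sigma^2 pi du/dx).  As h is
   only square integrable, the equation is written in integrated form, i.e. the
   flux is locally absolutely continuous with derivative - pi h a.e. *)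
Definition SL_graph (x1 x2 : \bar R) pi sigma u h : Prop :=
  [/\ square_integrable x1 x2 pi u,
      square_integrable x1 x2 pi h,
      forall x, state_space x1 x2 x -> derivable u x 1,
      forall x y, state_space x1 x2 x -> state_space x1 x2 y -> x < y ->
        flux pi sigma u y - flux pi sigma u x =
        - \int[leb]_(z in `[x, y]) (h z * pi z) &
      reflecting x1 x2 pi sigma u].

(* lam is in the resolvent set: the operator minus lam is onto L^2(pi) and has
   a bounded inverse. *)
Definition resolvent_point (x1 x2 : \bar R) pi sigma lam : Prop :=
  (forall g, square_integrable x1 x2 pi g ->
    exists u, SL_graph x1 x2 pi sigma u (fun x => lam * u x + g x)) /\
  (exists C : R, forall u h, SL_graph x1 x2 pi sigma u h ->
    norm2_sq x1 x2 pi u <= C * norm2_sq x1 x2 pi (fun x => h x - lam * u x)).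

(* lam is the first discrete eigenvalue other than lambda_0 = 0: it is an
   eigenvalue, isolated in the spectrum, with no spectrum between 0 and lam.
   Eigenvalues embedded in, or lying above, a continuous spectrum are thereby
   excluded: they are not first, and they are not convergence rates. *)
Definition convergence_rate (x1 x2 : \bar R) pi sigma lam : Prop :=
  [/\ 0 < lam,
      eigenvalue x1 x2 pi sigma lam &
      exists2 e : R, 0 < e & forall l, 0 < l -> l < lam + e -> l != lam ->
        resolvent_point x1 x2 pi sigma l].

Definition optimal (x1 x2 : \bar R) pi sigma : Prop :=
  exists2 lam1, convergence_rate x1 x2 pi sigma lam1 &
    forall mu' sigma' lam1',
      reversible_diffusion x1 x2 pi mu' sigma' ->
      average_variance x1 x2 pi sigma' = average_variance x1 x2 pi sigma ->
      convergence_rate x1 x2 pi sigma' lam1' ->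
      lam1' <= lam1.

(* The last clause says that (x1, x2) is the natural state space of the
   polynomial coefficients, i.e. a maximal interval of positivity of sigma^2.
   Truncated processes have to be left out: Brownian motion reflected at 0 and 1
   (zero drift, constant sigma, uniform density) has a rate of about 9.87 A, with
   A the average variance, while the variance function 6 A x (1 - x) has the same
   average and the rate 12 A. *)
Definition pearson_diffusion (x1 x2 : \bar R) pi mu sigma : Prop :=
  reversible_diffusion x1 x2 pi mu sigma /\
  exists p q : {poly R},
    [/\ (size p <= 2)%N, (size q <= 3)%N,
        forall x, state_space x1 x2 x -> mu x = p.[x],
        forall x, state_space x1 x2 x -> variance_function sigma x = q.[x] &
        forall a : R, x1 = a%:E \/ x2 = a%:E -> q.[a] = 0].

End Diffusions.

(* Main.v *)
Require Import Defs.
From mathcomp Require Import all_boot all_order all_algebra.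
From mathcomp Require Import all_classical all_reals all_analysis.
From mathcomp Require Import unstable measurable_realfun ring lra.

Set Implicit Arguments.
Unset Strict Implicit.
Unset Printing Implicit Defensive.

Import Order.TTheory GRing.Theory Num.Theory.
Import numFieldNormedType.Exports.

Local Open Scope classical_set_scope.
Local Open Scope ring_scope.



(** Let x be the coordinate, m the mean of pi and k the slope of the Pearson drift
-k (x - m).  Writing G for sigma^2 pi / 2, detailed balance reads
G' = -k (x - m) pi, so x - m is an eigenfunction for the eigenvalue k with flux G,
and k Var(pi) is the average variance A.

No eigenvalue lies strictly between 0 and k: for an eigenfunction phi of
eigenvalue lam, with flux F, the function -k (x - m) F^2 / G + k F phi has
derivative at most -lam (k - lam) pi phi^2 and tends to 0 at both ends.

For any variance function with the same average A, the rate lam' satisfies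
lam' Var(pi) <= A, by testing against x - m.  Since x - m need not lie in the
operator domain, one proves the dual inequality lam' <Lu, u> <= |Lu|^2 from the
resolvent hypothesis, solves Lu = h explicitly for truncations h of x - m whose
flux is a function of G with compact support, and uses Cauchy-Schwarz in the form
<h, x - m>^2 <= A <Lu, u>.  Hence lam' <= k. *)

(** * Spectral gap of a symmetric operator *)

(** The rate of a competing diffusion is known through its resolvent, without any eigenfunction
    expansion, so invertibility of L - l for 0 < l < lam has to be turned into an inequality. With c
    = lam / 2 it yields (L - c)^2 >= c^2, which expands to lam <Lu, u> <= |Lu|^2. The resolvent
    bounds may depend on l in an uncontrolled way; enlarging r step by step in (L - c)^2 >= r^2
    copes with that. Constants satisfy the inequality trivially, which spares a projection onto
    their orthogonal complement, and it can be tested on any source h for which Lu = h is solved by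
    hand.

    The ends of the state space are the second obstacle. Fluxes vanish there, but u and x - m may be
    unbounded, so products of the two are made small only at well-chosen points. *)

Lemma quadratic_ge0_discriminant (R : realFieldType) (a b c : R) :
  0 <= c -> (forall t, 0 <= a - 2 * t * b + t ^+ 2 * c) -> b ^+ 2 <= a * c.
Proof.
move=> c0 H; have [c_gt0|] := ltP 0 c; last first.
  move=> c_le0; have c_eq0 : c = 0 by apply/eqP; rewrite eq_le c_le0.
  subst c; have [->|b0] := eqVneq b 0; first by rewrite expr0n/= mulr0.
  (* With [c] = 0 the polynomial is affine in t; this t gives it the value -1. *)
  have := H ((a + 1) / (2 * b)); rewrite mulr0 addr0.
  suff -> : a - 2 * ((a + 1) / (2 * b)) * b = -1 by rewrite lerNr oppr0 ler10.
  by field.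
have := H (b / c).
rewrite -(@pmulr_rge0 _ c)//.
suff -> : c * (a - 2 * (b / c) * b + (b / c) ^+ 2 * c) = a * c - b ^+ 2.
  by rewrite subr_ge0.
by field; rewrite gt_eqF.
Qed.

Section spectral_gap.
Context {R : realType} (V : Type) (comb : R -> V -> V -> V) (S : set V).
Context (ip : V -> V -> R) (L : V -> V -> Prop).

(* [comb a u v] stands for a u + v, and [L u h] for the graph of an operator u |-> h. *)
Hypothesis S_comb : forall a u v, S u -> S v -> S (comb a u v).
Hypothesis ipC : forall u v, ip u v = ip v u.
Hypothesis ip_combl : forall a u v w, S u -> S v -> S w ->
  ip (comb a u v) w = a * ip u w + ip v w.
Hypothesis ip_ge0 : forall u, 0 <= ip u u.
Hypothesis LS : forall u h, L u h -> S u /\ S h.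
Hypothesis L_comb : forall a u h v k, L u h -> L v k ->
  L (comb a u v) (comb a h k).
Hypothesis L_sym : forall u h v k, L u h -> L v k -> ip h v = ip u k.

Lemma ip_cauchy_schwarz u v : S u -> S v -> ip u v ^+ 2 <= ip u u * ip v v.
Proof.
move=> Su Sv; apply: quadratic_ge0_discriminant => // t.
have := ip_ge0 (comb (- t) v u).
rewrite ip_combl//; last exact: S_comb.
rewrite ipC [X in _ + X]ipC !ip_combl// (ipC v u); nra.
Qed.

Variable lam : R.
Hypothesis lam_gt0 : 0 < lam.
Hypothesis res : forall l : R, 0 < l < lam ->
  (forall g, S g -> exists u, L u (comb l u g)) /\
  exists C, forall u h, L u h ->
    ip u u <= C * ip (comb (- l) u h) (comb (- l) u h).

Let c := lam / 2.

(* [|(L - c) u| >= r |u|], squared and expanded. *)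
Let bounded_below (r : R) := forall u h, L u h ->
  r ^+ 2 * ip u u <= ip h h - 2 * c * ip h u + c ^+ 2 * ip u u.

(* [(L - c)^2 - r^2 = (L - c - r) (L - c + r)] is nonnegative with a bounded
   inverse, hence bounded away from 0. *)
Lemma bounded_below_improve (r : R) : 0 <= r < c -> bounded_below r ->
  exists2 K, 0 < K & forall u h, L u h ->
    (r ^+ 2 + K^-1) * ip u u <= ip h h - 2 * c * ip h u + c ^+ 2 * ip u u.
Proof.
move=> /andP[r0 rc] Hr.
(* As [c] is half of [lam], r < c puts both points where resolvents exist. *)
have [lam_plus lam_minus] : 0 < c + r < lam /\ 0 < c - r < lam.
  by rewrite /c in rc *; split; apply/andP; split; lra.
have [ontop [Cp boundp]] := res lam_plus.
have [ontom [Cm boundm]] := res lam_minus.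
pose M := (1 + `|Cm|) * (1 + `|Cp|).
have M_gt0 : 0 < M by rewrite mulr_gt0// ltr_pwDl.
exists (1 + M); first by rewrite ltr_pwDl// ltW.
move=> u h uh.
have [Su Sh] := LS uh.
(* Here (L - (c + r)) w1 = u and (L - (c - r)) w = w1, so w is the inverse of (L - c)^2 - r^2
   applied to u. *)
have [w1 w1L] := ontop u Su; have [Sw1 Sk1] := LS w1L.
have [w wL] := ontom w1 Sw1; have [Sw Sk] := LS wL.
set k1 := comb (c + r) w1 u in w1L Sk1; set k := comb (c - r) w w1 in wL Sk.
(* The weak form <(L - c) z, (L - c) w> - r^2 <z, w> = <z, u>, for every z in the domain. *)
have key z hz : L z hz -> ip hz k - c * ip hz w - c * ip z k +
    (c ^+ 2 - r ^+ 2) * ip z w = ip z u.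
  move=> zL; have [Sz Shz] := LS zL.
  have e1 : ip hz k = (c - r) * ip hz w + ip hz w1.
    by rewrite ipC ip_combl// !(ipC hz).
  have e2 : ip z k = (c - r) * ip z w + ip z w1.
    by rewrite ipC ip_combl// !(ipC z).
  have e3 : ip z k1 = (c + r) * ip z w1 + ip z u.
    by rewrite ipC ip_combl// !(ipC z).
  have e4 := L_sym zL wL; have e5 := L_sym zL w1L.
  rewrite e1 e5 e4 e3 e2; ring.
have kw := key _ _ wL; have ku := key _ _ uh.
have ww1 : ip w w <= (1 + `|Cm|) * ip w1 w1.
  apply: le_trans (boundm _ _ wL) _.
  have -> : ip (comb (- (c - r)) w k) (comb (- (c - r)) w k) = ip w1 w1.
    have Skk : S (comb (- (c - r)) w k) by exact: S_comb.
    have h1 v : S v -> ip (comb (- (c - r)) w k) v = ip w1 v.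
      by move=> Sv; rewrite ip_combl// ip_combl//; ring.
    by rewrite h1// ipC h1.
  by rewrite ler_wpM2r// (le_trans (ler_norm _))// lerDr.
have w1u : ip w1 w1 <= (1 + `|Cp|) * ip u u.
  apply: le_trans (boundp _ _ w1L) _.
  have -> : ip (comb (- (c + r)) w1 k1) (comb (- (c + r)) w1 k1) = ip u u.
    have Skk : S (comb (- (c + r)) w1 k1) by exact: S_comb.
    have h1 v : S v -> ip (comb (- (c + r)) w1 k1) v = ip u v.
      by move=> Sv; rewrite ip_combl// ip_combl//; ring.
    by rewrite h1// ipC h1.
  by rewrite ler_wpM2r// (le_trans (ler_norm _))// lerDr.
have wwu : ip w w <= M * ip u u.
  apply: le_trans ww1 _; rewrite /M -mulrA ler_wpM2l//.
(* Cauchy-Schwarz and M <= (1 + M)^2, which avoids a square root. *)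
have wu : ip w u <= (1 + M) * ip u u.
  have cs := ip_cauchy_schwarz Sw Su.
  have R_ge0 : 0 <= (1 + M) * ip u u by rewrite mulr_ge0// addr_ge0// ltW.
  rewrite (le_trans (ler_norm _))// -ler_sqr ?nnegrE// real_normK ?num_real//.
  apply: le_trans cs _; rewrite exprMn expr2 (expr2 (ip u u)) mulrA.
  rewrite ler_wpM2r//; apply: le_trans wwu _.
  by rewrite ler_wpM2r//; nra.
have := ip_ge0 u; rewrite le_eqVlt => /predU1P[u0|u_gt0].
  by have := Hr _ _ uh; rewrite -u0 !mulr0.
(* [B] is b(u, u) for the form b(y, z) = <(L - c) y, (L - c) z> - r^2 <y, z>. By [key], b(u, w) =
   <u, u> and b(w, w) = <w, u>, so [cs] is the Cauchy-Schwarz inequality of the nonnegative form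
   b. *)
pose B := ip h h - 2 * c * ip h u + c ^+ 2 * ip u u - r ^+ 2 * ip u u.
have cs : ip u u ^+ 2 <= B * ip w u.
  apply: quadratic_ge0_discriminant.
    have := Hr _ _ wL; rewrite -kw -(L_sym wL wL); lra.
  move=> t; have := L_comb (- t) wL uh.
  move=> zL; have := Hr _ _ zL.
  have [Sz Skh] := LS zL.
  have exp a b a' b' : S a -> S b -> S a' -> S b' ->
      ip (comb (- t) a b) (comb (- t) a' b') =
      t ^+ 2 * ip a a' - t * ip a b' - t * ip b a' + ip b b'.
    move=> Sa Sb Sa' Sb'; have Sab' : S (comb (- t) a' b') by exact: S_comb.
    rewrite ip_combl// !(ipC _ (comb _ _ _)) !ip_combl//.
    rewrite (ipC a' a) (ipC b' a) (ipC a' b) (ipC b' b); ring.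
  rewrite !exp// => H.
  have e1 := ipC k h; have e3 := L_sym uh wL.
  have e4 := ipC k u; have e5 := L_sym wL wL; have e6 := L_sym wL uh.
  suff : 0 <= B - 2 * t * (ip h k - c * ip h w - c * ip u k +
      (c ^+ 2 - r ^+ 2) * ip u w) + t ^+ 2 * (ip k k - c * ip k w -
      c * ip w k + (c ^+ 2 - r ^+ 2) * ip w w) by rewrite ku kw.
  move: H; rewrite -subr_ge0 /B e5 e3 e1 e6 (ipC w h) e3 (ipC w u).
  move=> /le_trans; apply; rewrite le_eqVlt; apply/predU1P; left; ring.
have B_ge : ip u u <= (1 + M) * B.
  have B_ge0 : 0 <= B by rewrite subr_ge0; exact: Hr uh.
  rewrite -(ler_pM2r u_gt0) -expr2 (le_trans cs)//.
  by rewrite mulrAC [leLHS]mulrC ler_wpM2r.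
have M1_gt0 : 0 < 1 + M by rewrite ltr_pwDl// ltW.
rewrite mulrDl -lerBrDl -(ler_pM2l M1_gt0) mulrA divff ?mul1r// gt_eqF//.
Qed.

(** Take the largest r in [0, c] with |(L - c) u| >= r |u|. The condition is closed, so the supremum
    satisfies it; were it below c, [bounded_below_improve] would enlarge it. For r = c the terms c^2
    |u|^2 cancel and leave the claim. *)
Lemma spectral_gap_le u h : L u h -> lam * ip h u <= ip h h.
Proof.
have c_gt0 : 0 < c by rewrite divr_gt0.
pose A := [set r | 0 <= r <= c /\ bounded_below r].
have A0 : A 0.
  split; first by rewrite lexx ltW.
  move=> v k vk; have [Sv Sk] := LS vk; have := ip_ge0 (comb (- c) v k).
  rewrite ip_combl//; last exact: S_comb.
  rewrite ipC [X in _ + X]ipC !ip_combl// (ipC v k); nra.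
have supA : has_sup A by split; [exists 0|exists c => r [/andP[]]].
set r0 := sup A.
have r0_ge0 : 0 <= r0 by exact: (@sup_upper_bound _ _ supA 0 A0).
have r0_lec : r0 <= c by apply: ge_sup; [exists 0|move=> r [/andP[]]].
have Hr0 : bounded_below r0.
  move=> v k vk; set X := leRHS.
  have := ip_ge0 v; rewrite le_eqVlt => /predU1P[v0|v_gt0].
    by have := A0.2 _ _ vk; rewrite -/X -v0 !mulr0.
  have X0 : 0 <= X by have := A0.2 _ _ vk; rewrite expr0n/= mul0r.
  (* The square root turns the bounds on r^2 into an upper bound of [A], to be compared with its
     supremum. *)
  have : r0 <= Num.sqrt (X / ip v v).
    apply: ge_sup; first by exists 0.
    move=> r [/andP[r_ge0 _] Hr]; rewrite -(ler_sqr r_ge0) ?nnegrE ?sqrtr_ge0//.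
    by rewrite sqr_sqrtr ?divr_ge0// ler_pdivlMr//; exact: Hr vk.
  rewrite -(@ler_sqr _ r0) ?nnegrE ?sqrtr_ge0// sqr_sqrtr ?divr_ge0//.
  by rewrite ler_pdivlMr.
have r0c : r0 = c.
  apply/eqP; rewrite eq_le r0_lec/= leNgt; apply/negP => r0_ltc.
  have [|K K_gt0 HK] := bounded_below_improve _ Hr0; first by rewrite r0_ge0.
  (* (r0 + d)^2 - r0^2 = d (2 r0 + d) <= 3 c d, since r0 and d are at most c; hence the constant 3 c
     K. *)
  pose d := Num.min (c - r0) (3 * c * K)^-1.
  have d_gt0 : 0 < d by rewrite lt_min subr_gt0 r0_ltc invr_gt0 !mulr_gt0.
  have d_le : d <= c - r0 by rewrite ge_min lexx.
  have dK : d * (3 * c) <= K^-1.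
    have : d <= (3 * c * K)^-1 by rewrite ge_min lexx orbT.
    rewrite invfM -ler_pdivlMr ?mulr_gt0// [X in _ <= X]mulrC.
    by rewrite mulrC.
  have : r0 + d <= r0.
    apply: (@sup_upper_bound _ _ supA); split.
      by apply/andP; split; [exact: addr_ge0 r0_ge0 (ltW d_gt0)|rewrite -lerBrDl].
    move=> v k vk; apply: le_trans (HK _ _ vk).
    rewrite ler_wpM2r//; nra.
  by rewrite gerDl leNgt d_gt0.
move=> uh; have := Hr0 _ _ uh; rewrite r0c -subr_ge0.
rewrite /c; lra.
Qed.

End spectral_gap.

(** * State spaces and integration *)

Section state_space_topology.
Context {R : realType} (x1 x2 : \bar R).
Notation I := (state_space x1 x2).

Lemma state_space_open : open I.
Proof.
rewrite (_ : I = [set x | (x1 < x%:E)%E] `&` [set x | (x%:E < x2)%E])//.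
apply: openI.
- case: x1 => [a| |].
  + rewrite (_ : mkset _ = [set x | a < x]); first exact: open_gt.
    by apply/seteqP; split => x /=; rewrite lte_fin.
  + rewrite (_ : mkset _ = set0); first exact: open0.
    by apply/seteqP; split => x //=; rewrite ltNge leey.
  + rewrite (_ : mkset _ = setT); first exact: openT.
    by apply/seteqP; split => x //= _; rewrite ltNyr.
- case: x2 => [a| |].
  + rewrite (_ : mkset _ = [set x | x < a]); first exact: open_lt.
    by apply/seteqP; split => x /=; rewrite lte_fin.
  + rewrite (_ : mkset _ = setT); first exact: openT.
    by apply/seteqP; split => x //= _; rewrite ltry.
  + rewrite (_ : mkset _ = set0); first exact: open0.
    by apply/seteqP; split => x //=; rewrite ltNge leNye.
Qed.

Lemma state_space_measurable : measurable I.
Proof. exact: open_measurable state_space_open. Qed.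

Lemma state_space_nbhs x : I x -> nbhs x I.
Proof. by move=> Ix; apply: open_nbhs_nbhs; split => //; exact: state_space_open. Qed.

Lemma state_space_itv x y z : I x -> I y -> x <= z <= y -> I z.
Proof.
move=> [x1x _] [_ yx2] /andP[xz zy]; split.
  by rewrite (lt_le_trans x1x)// lee_fin.
by rewrite (le_lt_trans _ yx2)// lee_fin.
Qed.

Lemma itvcc_state_space x y : I x -> I y -> `[x, y] `<=` I.
Proof. by move=> Ix Iy z /=; rewrite in_itv/=; exact: state_space_itv. Qed.

Lemma state_space_nonempty : (x1 < x2)%E -> exists x, I x.
Proof.
move=> x12; suff : exists x : R, (x1 < x%:E < x2)%E by move=> [x /andP[]]; exists x.
case: x1 x2 x12 => [a| |] [b| |]//; rewrite ?lte_fin => h.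
- by exists ((a + b) / 2); rewrite !lte_fin !midf_lt.
- by exists (a + 1); rewrite lte_fin ltrDl ltr01 ltry.
- by exists (b - 1); rewrite lte_fin ltNyr/= ltrBlDr ltrDl ltr01.
- by exists 0; rewrite ltNyr ltry.
Qed.

(** A common form for finite and infinite ends, so that limits are handled without case distinction.
    The point [x0] rules out x1 = +oo, for which [lower_end] takes its default value. *)
Lemma lower_endP (x0 : R) (P : set R) : I x0 ->
  lower_end x1 P <-> exists2 c, I c & forall y, I y -> y <= c -> P y.
Proof.
move=> Ix0; have [lt1 lt2] := Ix0; rewrite /lower_end; case: x1 Ix0 lt1 => [a| |].
- move=> Ix0; rewrite lte_fin => ax0; split.
    move=> [e /= e0 He]; pose c := Num.min (a + e / 2) x0.
    have ac : a < c by rewrite lt_min ax0 ltrDl divr_gt0.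
    have cx0 : c <= x0 by rewrite ge_min lexx orbT.
    exists c.
      split; first by rewrite lte_fin.
      by rewrite (le_lt_trans _ lt2)// lee_fin.
    move=> y [] ; rewrite lte_fin => ay _ yc; apply: He => //.
    rewrite /ball/= distrC ger0_norm ?subr_ge0 ?ltW//.
    rewrite ltrBlDl (le_lt_trans yc)// gt_min; apply/orP; left.
    by rewrite ltrD2l ltr_pdivrMr// mulr_natr mulr2n ltrDl.
  move=> [c [ac cx2] H]; rewrite lte_fin in ac; exists (c - a) => /=.
    by rewrite subr_gt0.
  move=> y; rewrite /ball/= distrC => hy ay; apply: H; last first.
    by rewrite -(lerD2r (- a)) ltW// (le_lt_trans _ hy)// ler_norm.
  split; first by rewrite lte_fin.
  rewrite (le_lt_trans _ cx2)// lee_fin.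
  by rewrite -(lerD2r (- a)) ltW// (le_lt_trans _ hy)// ler_norm.
- by move=> _; rewrite ltNge leey.
- move=> Ix0 _; split.
    move=> [M [_ HM]]; exists (Num.min (M - 1) x0).
      split; first by rewrite ltNyr.
      by rewrite (le_lt_trans _ lt2)// lee_fin ge_min lexx orbT.
    move=> y _ yc; apply: HM; rewrite (le_lt_trans yc)// gt_min.
    by apply/orP; left; rewrite ltrBlDr ltrDl.
  move=> [c [_ cx2] H]; exists c; split; first exact: num_real.
  move=> y yc; apply: H; last exact: ltW.
  by split; [rewrite ltNyr|rewrite (lt_trans _ cx2)// lte_fin].
Qed.

Lemma upper_endP (x0 : R) (P : set R) : I x0 ->
  upper_end x2 P <-> exists2 d, I d & forall y, I y -> d <= y -> P y.
Proof.
move=> Ix0; have [lt1 lt2] := Ix0; rewrite /upper_end; case: x2 Ix0 lt2 => [b| |].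
- move=> Ix0; rewrite lte_fin => x0b; split.
    move=> [e /= e0 He]; pose c := Num.max (b - e / 2) x0.
    have cb : c < b by rewrite gt_max x0b ltrBlDr ltrDl divr_gt0.
    have cx0 : x0 <= c by rewrite le_max lexx orbT.
    exists c.
      split; last by rewrite lte_fin.
      by rewrite (lt_le_trans lt1)// lee_fin.
    move=> y [_] ; rewrite lte_fin => yb cy; apply: He => //.
    rewrite /ball/= ger0_norm ?subr_ge0 ?ltW//.
    rewrite ltrBlDl -ltrBlDr (lt_le_trans _ cy)// lt_max; apply/orP; left.
    by rewrite ltrD2l ltrN2 ltr_pdivrMr// mulr_natr mulr2n ltrDl.
  move=> [c [x1c cb] H]; rewrite lte_fin in cb; exists (b - c) => /=.
    by rewrite subr_gt0.
  move=> y; rewrite /ball/= => hy yb.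
  have cy : c <= y.
    by rewrite -lerN2 -(lerD2l b) ltW// (le_lt_trans _ hy)// ler_norm.
  apply: H => //; split; last by rewrite lte_fin.
  by rewrite (lt_le_trans x1c)// lee_fin.
- move=> Ix0 _; split.
    move=> [M [_ HM]]; exists (Num.max (M + 1) x0).
      split; last by rewrite ltry.
      by rewrite (lt_le_trans lt1)// lee_fin le_max lexx orbT.
    move=> y _ cy; apply: HM; rewrite (lt_le_trans _ cy)// lt_max.
    by apply/orP; left; rewrite ltrDl.
  move=> [c [x1c _] H]; exists c; split; first exact: num_real.
  move=> y cy; apply: H; last exact: ltW.
  by split; [rewrite (lt_trans x1c)// lte_fin|rewrite ltry].
- by move=> _; rewrite ltNge leNye.
Qed.

Lemma lower_end_filter (x0 : R) : I x0 -> ProperFilter (lower_end x1).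
Proof.
move=> [x1x0 _]; rewrite /lower_end; case: x1 x1x0 => [a| |] => h.
- exact: at_right_proper_filter.
- by move: h; rewrite ltNge leey.
- exact: proper_ninfty_nbhs.
Qed.

Lemma upper_end_filter (x0 : R) : I x0 -> ProperFilter (upper_end x2).
Proof.
move=> [_ x0x2]; rewrite /upper_end; case: x2 x0x2 => [a| |] => h.
- exact: at_left_proper_filter.
- exact: proper_pinfty_nbhs.
- by move: h; rewrite ltNge leNye.
Qed.

Lemma lower_end_cvg0P (x0 : R) (F : R -> R) : I x0 ->
  F x @[x --> lower_end x1] --> 0 <->
  forall e, 0 < e -> exists2 c, I c & forall y, I y -> y <= c -> `|F y| <= e.
Proof.
move=> Ix0; have PF := lower_end_filter Ix0; split.
  move=> /cvgrPdist_le H e /H /(lower_endP _ Ix0)[c Ic Hc]; exists c => // y Iy yc.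
  by have := Hc _ Iy yc; rewrite sub0r normrN.
move=> H; apply/cvgrPdist_le => e /H[c Ic Hc].
apply/(lower_endP _ Ix0); exists c => // y Iy yc.
by rewrite sub0r normrN; exact: Hc.
Qed.

Lemma upper_end_cvg0P (x0 : R) (F : R -> R) : I x0 ->
  F x @[x --> upper_end x2] --> 0 <->
  forall e, 0 < e -> exists2 d, I d & forall y, I y -> d <= y -> `|F y| <= e.
Proof.
move=> Ix0; have PF := upper_end_filter Ix0; split.
  move=> /cvgrPdist_le H e /H /(upper_endP _ Ix0)[c Ic Hc]; exists c => // y Iy yc.
  by have := Hc _ Iy yc; rewrite sub0r normrN.
move=> H; apply/cvgrPdist_le => e /H[c Ic Hc].
apply/(upper_endP _ Ix0); exists c => // y Iy yc.
by rewrite sub0r normrN; exact: Hc.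
Qed.

Lemma state_space_lt_ex x : I x -> exists2 y, I y & y < x.
Proof.
move=> Ix; have [e /= e0 He] := state_space_nbhs Ix.
exists (x - e / 2); last by rewrite ltrBlDr ltrDl divr_gt0.
apply: He; rewrite /ball/= opprB addrC subrK ger0_norm ?divr_ge0 ?ltW//.
by rewrite ltr_pdivrMr// mulr_natr mulr2n ltrDl.
Qed.

Lemma state_space_gt_ex x : I x -> exists2 y, I y & x < y.
Proof.
move=> Ix; have [e /= e0 He] := state_space_nbhs Ix.
exists (x + e / 2); last by rewrite ltrDl divr_gt0.
apply: He; rewrite /ball/= opprD addrA subrr sub0r normrN ger0_norm ?divr_ge0 ?ltW//.
by rewrite ltr_pdivrMr// mulr_natr mulr2n ltrDl.
Qed.

Lemma state_space_min x y : I x -> I y -> I (Num.min x y).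
Proof. by rewrite minEle; case: ifP. Qed.

Lemma state_space_max x y : I x -> I y -> I (Num.max x y).
Proof. by rewrite maxEle; case: ifP. Qed.

End state_space_topology.

(** * Exhaustion of the state space by compact intervals *)

Section exhaustion.
Context {R : realType} (x1 x2 : \bar R).
Notation I := (state_space x1 x2).
Notation leb := (@lebesgue_measure R).

Lemma state_space_lower_seq (x0 : R) : I x0 -> exists c : nat -> R,
  [/\ forall n, I (c n), {homo c : m n / (m <= n)%N >-> n <= m} &
      forall y, I y -> exists n, c n <= y].
Proof.
move=> [x1x0 x0x2]; case: x1 x1x0 => [a| |]; last 2 first.
- by rewrite ltNge leey.
- move=> _; exists (fun n => x0 - n%:R); split.
  + move=> n; split; first by rewrite ltNyr.
    by rewrite (le_lt_trans _ x0x2)// lee_fin gerBl.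
  + by move=> m n mn; rewrite lerD2l lerN2 ler_nat.
  + move=> y _; have := ltr_bound (x0 - y).
    by exists (Num.bound (x0 - y)); lra.
rewrite lte_fin => ax0; exists (fun n => a + (x0 - a) / n.+1%:R); split.
- move=> n; split; first by rewrite lte_fin ltrDl divr_gt0 ?subr_gt0.
  rewrite (le_lt_trans _ x0x2)// lee_fin -lerBrDl.
  by rewrite ler_pdivrMr// ler_peMr ?subr_ge0 ?(ltW ax0)// ler1n.
- move=> m n mn; rewrite lerD2l ler_wpM2l ?subr_ge0 ?(ltW ax0)//.
  by rewrite lef_pV2 ?posrE// ler_nat.
- move=> y [+ _]; rewrite lte_fin => ay.
  exists (Num.bound ((x0 - a) / (y - a))).
  rewrite -lerBrDl ler_pdivrMr// mulrC -ler_pdivrMr ?subr_gt0//.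
  by rewrite (le_trans (ltW (ltr_bound _)))// ler_nat.
Qed.

Lemma state_space_upper_seq (x0 : R) : I x0 -> exists d : nat -> R,
  [/\ forall n, I (d n), {homo d : m n / (m <= n)%N >-> m <= n} &
      forall y, I y -> exists n, y <= d n].
Proof.
move=> [x1x0 x0x2]; case: x2 x0x2 => [b| |]; last 2 first.
- move=> _; exists (fun n => x0 + n%:R); split.
  + move=> n; split; last by rewrite ltry.
    by rewrite (lt_le_trans x1x0)// lee_fin lerDl.
  + by move=> m n mn; rewrite lerD2l ler_nat.
  + move=> y _; have := ltr_bound (y - x0).
    by exists (Num.bound (y - x0)); lra.
- by rewrite ltNge leNye.
rewrite lte_fin => x0b; exists (fun n => b - (b - x0) / n.+1%:R); split.
- move=> n; split; last by rewrite lte_fin ltrBlDr ltrDl divr_gt0 ?subr_gt0.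
  rewrite (lt_le_trans x1x0)// lee_fin lerBrDr -lerBrDl.
  by rewrite ler_pdivrMr// ler_peMr ?subr_ge0 ?(ltW x0b)// ler1n.
- move=> m n mn; rewrite lerD2l lerN2 ler_wpM2l ?subr_ge0 ?(ltW x0b)//.
  by rewrite lef_pV2 ?posrE// ler_nat.
- move=> y [_]; rewrite lte_fin => yb.
  exists (Num.bound ((b - x0) / (b - y))).
  rewrite lerBrDr -lerBrDl ler_pdivrMr// mulrC -ler_pdivrMr ?subr_gt0//.
  by rewrite (le_trans (ltW (ltr_bound _)))// ler_nat.
Qed.

Lemma integrable_itvcc (f : R -> \bar R) c d : I c -> I d ->
  leb.-integrable I f -> leb.-integrable `[c, d] f.
Proof.
move=> Ic Id; apply: integrableS => //; first exact: state_space_measurable.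
exact: itvcc_state_space.
Qed.

(** Monotone convergence along one increasing sequence of compact intervals; as f >= 0, every larger
    interval inherits the bound. *)
Lemma integral_exhaustion (f : R -> R) (e : R) :
  (x1 < x2)%E -> 0 < e -> leb.-integrable I (EFin \o f) ->
  (forall x, I x -> 0 <= f x) ->
  exists c0 d0, [/\ I c0, I d0, c0 <= d0 & forall c d, I c -> I d ->
    c <= c0 -> d0 <= d ->
    \int[leb]_(x in I) f x - e <= \int[leb]_(x in `[c, d]) f x].
Proof.
move=> x12 e0 intf f0; have [x0 Ix0] := state_space_nonempty x12.
have [c [Ic cni cI]] := state_space_lower_seq Ix0.
have [d [Id dnd dI]] := state_space_upper_seq Ix0.
pose F n := `[c n, d n]%classic.
have IE : I = \bigcup_n F n.
  apply/seteqP; split => x.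
    move=> Ix; have [m cx] := cI _ Ix; have [n xd] := dI _ Ix.
    exists (maxn m n) => //; rewrite /F/= in_itv/=; apply/andP; split.
      by rewrite (le_trans _ cx)// cni// leq_maxl.
    by rewrite (le_trans xd)// dnd// leq_maxr.
  by move=> [n _]; exact: itvcc_state_space.
have FI n : F n `<=` I by exact: itvcc_state_space.
have mI := @state_space_measurable _ x1 x2.
have ndF : nondecreasing_seq F.
  move=> m n mn; rewrite subsetEset /F => x /=. rewrite !in_itv/= => /andP[h1 h2].
  by rewrite (le_trans (cni _ _ mn) h1) (le_trans h2 (dnd _ _ mn)).
have intF n : leb.-integrable (F n) (EFin \o f).
  by apply: integrableS intf => //; exact: measurable_itv.
have cvgF : (\int[leb]_(x in F i) (f x)%:E @[i --> \oo] -->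
    \int[leb]_(x in I) (f x)%:E)%E.
  rewrite IE; apply: ge0_nondecreasing_set_cvg_integral => //.
  - by move=> n; exact: measurable_itv.
  - by move=> n; exact: measurable_int (intF n).
  - by move=> n x /FI Ix; rewrite lee_fin f0.
have fin : (\int[leb]_(x in I) (f x)%:E \is a fin_num)%E.
  exact: integrable_fin_num.
have cvgR : \int[leb]_(x in F i) f x @[i --> \oo] --> \int[leb]_(x in I) f x.
  by apply: fine_cvg; rewrite fineK.
move/cvgrPdist_le : cvgR => /(_ _ e0)[n _ /(_ n (leqnn n)) Hn].
(* Including [x0] guarantees c0 <= d0. *)
exists (Num.min (c n) x0), (Num.max (d n) x0); split.
- exact: state_space_min.
- exact: state_space_max.
- by rewrite (@le_trans _ _ x0)// ?ge_min ?le_max lexx orbT.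
move=> c' d' Ic' Id'; rewrite le_min ge_max => /andP[c'c _] /andP[dd' _].
rewrite lerBlDr -lerBlDl; apply: le_trans (le_trans (ler_norm _) Hn).
rewrite lerD2l lerN2; apply: fine_le.
- by apply: (integrable_fin_num _ (intF n)); exact: measurable_itv.
- apply: integrable_fin_num => //; exact: integrable_itvcc intf.
apply: ge0_subset_integral => //; first exact: measurable_itv.
- by have /integrableP[] := integrable_itvcc Ic' Id' intf.
- by move=> x /(itvcc_state_space Ic' Id') Ix; rewrite lee_fin f0.
- move=> x; rewrite /F/= !in_itv/= => /andP[h1 h2].
  by rewrite (le_trans c'c h1) (le_trans h2 dd').
Qed.

End exhaustion.

(** * Differential and integral calculus on the state space *)

Section calculus.
Context {R : realType}.
Notation leb := (@lebesgue_measure R).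
Implicit Types (F f : R -> R).

Lemma is_derive_derive1 F x : derivable F x 1 -> is_derive x (1 : R) F (derive1 F x).
Proof. by move=> dF; rewrite derive1E; exact: derivableP. Qed.

Lemma is_derive_continuous F x l : is_derive x (1 : R) F l -> {for x, continuous F}.
Proof.
by move=> [dF _]; apply: differentiable_continuous; exact/derivable1_diffP.
Qed.

Lemma is_derive_derive1E F x l : is_derive x (1 : R) F l -> derive1 F x = l.
Proof. by move=> dF; rewrite derive1E derive_val. Qed.

Lemma is_derive_ge0_le F f (x y : R) : x <= y ->
  (forall z, x <= z <= y -> is_derive z (1 : R) F (f z) /\ 0 <= f z) -> F x <= F y.
Proof.
rewrite le_eqVlt => /predU1P[->//|xy] H.
have [||z] := @MVT _ F f x y xy.
- by move=> z /[!in_itv]/= /andP[xz zy]; apply: (H _ _).1; rewrite !ltW.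
- apply: derivable_within_continuous => z /[!in_itv]/= xzy.
  by have [[]] := H z xzy.
rewrite in_itv/= => /andP[xz zy] /eqP; rewrite subr_eq => /eqP ->.
by rewrite lerDr mulr_ge0 ?subr_ge0 ?(ltW xy)//; apply: (H _ _).2; rewrite !ltW.
Qed.

Lemma is_derive_le0_ge F f (x y : R) : x <= y ->
  (forall z, x <= z <= y -> is_derive z (1 : R) F (f z) /\ f z <= 0) -> F y <= F x.
Proof.
move=> xy H; rewrite -lerN2.
apply: (@is_derive_ge0_le (fun z => - F z) (fun z => - f z)) => // z xzy.
by have [? ?] := H z xzy; split; [exact: is_deriveN|rewrite oppr_ge0].
Qed.

Lemma integrable_scale (D : set R) f a : measurable D ->
  leb.-integrable D (EFin \o f) -> leb.-integrable D (EFin \o (fun x => a * f x)).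
Proof.
move=> mD intf; rewrite (_ : EFin \o _ = (fun x => a%:E * (EFin \o f) x)%E).
  exact: integrableZl.
by apply/funext => x /=; rewrite EFinM.
Qed.

Lemma integrable_comb (D : set R) f g a : measurable D ->
  leb.-integrable D (EFin \o f) -> leb.-integrable D (EFin \o g) ->
  leb.-integrable D (EFin \o (fun x => a * f x + g x)).
Proof.
move=> mD intf intg.
rewrite (_ : EFin \o _ = (fun x => (a * f x)%R%:E + (g x)%:E)%E).
  by apply: integrableD => //; exact: (integrable_scale _ mD intf).
by apply/funext => x /=; rewrite EFinD.
Qed.

Lemma Rintegral_comb (D : set R) f g a : measurable D ->
  leb.-integrable D (EFin \o f) -> leb.-integrable D (EFin \o g) ->
  \int[leb]_(x in D) (a * f x + g x) =
  a * \int[leb]_(x in D) f x + \int[leb]_(x in D) g x.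
Proof.
by move=> mD intf intg; rewrite RintegralD// ?RintegralZl//; exact: integrable_scale.
Qed.

Section on_state_space.
Variables (x1 x2 : \bar R).
Notation I := (state_space x1 x2).

Lemma continuous_measurable_state_space f :
  (forall x, I x -> {for x, continuous f}) -> measurable_fun I f.
Proof.
move=> cf; apply: open_continuous_measurable_fun; first exact: state_space_open.
by move=> x; rewrite inE; exact: cf.
Qed.

Lemma continuous_within_itvcc f c d : I c -> I d ->
  (forall x, I x -> {for x, continuous f}) -> {within `[c, d], continuous f}.
Proof.
move=> Ic Id cf; apply: continuous_in_subspaceT => x.
by rewrite inE => /(itvcc_state_space Ic Id) Ix; exact: cf.
Qed.

Lemma continuous_integrable_itvcc f c d : I c -> I d ->
  (forall x, I x -> {for x, continuous f}) -> leb.-integrable `[c, d] (EFin \o f).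
Proof.
move=> Ic Id cf; apply: continuous_compact_integrable.
  exact: segment_compact.
exact: continuous_within_itvcc.
Qed.

Lemma Rintegral_derive F f c d : I c -> I d -> c <= d ->
  (forall x, I x -> is_derive x (1 : R) F (f x)) ->
  (forall x, I x -> {for x, continuous f}) ->
  \int[leb]_(x in `[c, d]) f x = F d - F c.
Proof.
move=> Ic Id; rewrite le_eqVlt => /predU1P[<-|cd] dF cf.
  by rewrite set_itv1 Rintegral_set1 subrr.
have cF x : I x -> {for x, continuous F} by move=> /dF /is_derive_continuous.
have Ixx x : x \in `]c, d[ -> I x.
  rewrite in_itv/= => /andP[cx xd]; apply: (itvcc_state_space Ic Id).
  by rewrite /= in_itv/= !ltW.
rewrite /Rintegral (continuous_FTC2 cd (continuous_within_itvcc Ic Id cf) (F := F))//.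
- split.
  + by move=> x /Ixx /dF[].
  + exact/cvg_at_right_filter/cF.
  + exact/cvg_at_left_filter/cF.
- by move=> x /Ixx /dF /is_derive_derive1E.
Qed.

Lemma is_derive_Rintegral f x c F : I c -> c < x -> I x ->
  (forall y, I y -> {for y, continuous f}) ->
  (forall y, I y -> c < y -> F y = F c + \int[leb]_(z in `[c, y]) f z) ->
  is_derive x (1 : R) F (f x).
Proof.
move=> Ic cx Ix cf FE; have [d Id xd] := state_space_gt_ex Ix.
have [dP P'] := @continuous_FTC1 R f (BLeft c) x d xd
  (continuous_integrable_itvcc Ic Id cf) cx (cf _ Ix).
pose P := fun y => F c + \int[leb]_(z in `[c, y]) f z.
have nP : \forall y \near x, P y = F y.
  have := state_space_nbhs Ix; have := lt_nbhsr cx.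
  apply: filterS2 => y /= cy Iy.
  by rewrite /P -FE.
have dP' : is_derive x (1 : R) P (f x).
  rewrite -P' -[X in is_derive _ _ _ X]add0r; apply: is_deriveD.
  exact: is_derive_derive1.
exact: near_eq_is_derive dP'.
Qed.

Lemma Rintegral_itvcc_le f c d : I c -> I d -> leb.-integrable I (EFin \o f) ->
  (forall x, I x -> 0 <= f x) ->
  \int[leb]_(z in `[c, d]) f z <= \int[leb]_(z in I) f z.
Proof.
move=> Ic Id intf f0; have mI := @state_space_measurable _ x1 x2.
apply: fine_le.
- by apply: integrable_fin_num => //; exact: integrable_itvcc intf.
- exact: integrable_fin_num.
apply: ge0_subset_integral => //.
- exact: measurable_int intf.
- exact: itvcc_state_space.
Qed.

Lemma Rintegral_itvcc_split f c d e : I c -> I e -> c <= d <= e ->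
  leb.-integrable `[c, e] (EFin \o f) ->
  \int[leb]_(x in `[c, e]) f x =
  \int[leb]_(x in `[c, d]) f x + \int[leb]_(x in `[d, e]) f x.
Proof.
move=> Ic Ie /andP[cd de] intf; apply/eqP; rewrite addrC -subr_eq.
rewrite Rintegral_itvB ?bnd_simp// Rintegral_itv_obnd_cbnd//.
apply: integrableS intf => //; try exact: measurable_itv.
by apply: subset_itvr; rewrite bnd_simp.
Qed.

(** An interval outside [c0, d0] carries at most the mass that [c0, d0] leaves out. *)
Lemma integral_tail f (e : R) : (x1 < x2)%E -> 0 < e ->
  leb.-integrable I (EFin \o f) -> (forall x, I x -> 0 <= f x) ->
  exists c0 d0, [/\ I c0, I d0, c0 <= d0 & forall x y, I x -> I y -> x <= y ->
    y <= c0 \/ d0 <= x -> \int[leb]_(z in `[x, y]) f z <= e].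
Proof.
move=> x12 e0 intf f0.
have [c0 [d0 [Ic0 Id0 cd0 H]]] := integral_exhaustion x12 e0 intf f0.
exists c0, d0; split => // x y Ix Iy xy.
have sub c d (Ic : I c) (Id : I d) := Rintegral_itvcc_le Ic Id intf f0.
move=> [yc0|d0x].
- have := H x d0 Ix Id0 (le_trans xy yc0) (lexx _); have := sub x d0 Ix Id0.
  have yd0 : y <= d0 by exact: le_trans cd0.
  rewrite (@Rintegral_itvcc_split _ _ y)// ?xy//; last first.
    exact: integrable_itvcc intf.
  have := H y d0 Iy Id0 yc0 (lexx _); lra.
- have := sub c0 y Ic0 Iy.
  have c0x : c0 <= x by exact: le_trans d0x.
  rewrite (@Rintegral_itvcc_split _ _ x)// ?c0x//; last first.
    exact: integrable_itvcc intf.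
  have := H c0 x Ic0 Ix (lexx _) d0x; lra.
Qed.

(** Write f = |f| - (|f| - f): the mass missed by [c, d] lies in [0, e] for both terms, so the
    difference is at most e in absolute value. *)
Lemma integral_exhaustion_norm f (e : R) :
  (x1 < x2)%E -> 0 < e -> leb.-integrable I (EFin \o f) ->
  exists c0 d0, [/\ I c0, I d0, c0 <= d0 & forall c d, I c -> I d ->
    c <= c0 -> d0 <= d ->
    `|\int[leb]_(x in I) f x - \int[leb]_(x in `[c, d]) f x| <= e].
Proof.
move=> x12 e0 intf.
have mI := @state_space_measurable _ x1 x2.
have intn : leb.-integrable I (EFin \o (fun x => `|f x|)).
  exact: integrable_abse intf.
have intg : leb.-integrable I (EFin \o (fun x => `|f x| - f x)).
  rewrite (_ : EFin \o _ = EFin \o (fun x => (- 1) * f x + `|f x|)).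
    exact: integrable_comb.
  by apply/funext => x /=; rewrite mulN1r addrC.
have [c1 [d1 [Ic1 Id1 cd1 H1]]] :=
  integral_exhaustion x12 e0 intn (fun x _ => normr_ge0 _).
have [c2 [d2 [Ic2 Id2 cd2 H2]]] : exists c0 d0, [/\ I c0, I d0, c0 <= d0 &
    forall c d, I c -> I d -> c <= c0 -> d0 <= d ->
    \int[leb]_(x in I) (`|f x| - f x) - e <=
    \int[leb]_(x in `[c, d]) (`|f x| - f x)].
  by apply: integral_exhaustion => // x _; rewrite subr_ge0 ler_norm.
exists (Num.min c1 c2), (Num.max d1 d2); split.
- exact: state_space_min.
- exact: state_space_max.
- by rewrite ge_min le_max cd1.
move=> c d Ic Id; rewrite le_min ge_max => /andP[cc1 cc2] /andP[dd1 dd2].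
have ifcd : leb.-integrable `[c, d] (EFin \o f) by exact: integrable_itvcc intf.
have incd : leb.-integrable `[c, d] (EFin \o (fun x => `|f x|)).
  exact: integrable_itvcc intn.
have := H1 _ _ Ic Id cc1 dd1; have := H2 _ _ Ic Id cc2 dd2.
have h3 := Rintegral_itvcc_le Ic Id intn (fun x _ => normr_ge0 (f x)).
have h4 : \int[leb]_(z in `[c, d]) (`|f z| - f z) <=
    \int[leb]_(z in I) (`|f z| - f z).
  by apply: Rintegral_itvcc_le => // x _; rewrite subr_ge0 ler_norm.
move: h4; rewrite !RintegralB//; try exact: measurable_itv.
rewrite ler_norml => h4 h1 h2; apply/andP.
by split; move: h1 h2 h3 h4; clear; lra.
Qed.

End on_state_space.
End calculus.

(** * The weighted space and the Sturm-Liouville operator *)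

Section weighted_space.
Context {R : realType} (x1 x2 : \bar R) (pi : R -> R).
Notation leb := (@lebesgue_measure R).
Notation I := (state_space x1 x2).
Notation L2 := (square_integrable x1 x2 pi).
Implicit Types (u v w h k N : R -> R).

Hypothesis x12 : (x1 < x2)%E.
Hypothesis pi_gt0 : forall x, I x -> 0 < pi x.
Hypothesis pi_continuous : forall x, I x -> {for x, continuous pi}.
Hypothesis pi_mass : (\int[leb]_(x in I) (pi x)%:E = 1)%E.

Definition L2_product u v : R := \int[leb]_(x in I) (u x * v x * pi x).

Let mI : measurable I. Proof. exact: state_space_measurable. Qed.

Lemma density_measurable : measurable_fun I pi.
Proof. exact: continuous_measurable_state_space. Qed.

Lemma square_integrable_mul u v : L2 u -> L2 v ->
  leb.-integrable I (EFin \o (fun x => u x * v x * pi x)).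
Proof.
move=> [mu iu] [mv iv].
have mpi := density_measurable.
apply: (@le_integrable _ _ _ leb I mI _
    (EFin \o (fun x => 1 * (u x ^+ 2 * pi x) + v x ^+ 2 * pi x))).
- apply/measurable_EFinP; apply: measurable_funM => //.
  exact: measurable_funM.
- move=> x Ix; rewrite /= lee_fin mul1r -mulrDl !normrM ler_wpM2r//.
  rewrite -normrM ler_norml ger0_norm ?addr_ge0 ?sqr_ge0//.
  by apply/andP; split; have := sqr_ge0 (u x + v x); have := sqr_ge0 (u x - v x); nra.
- exact: integrable_comb.
Qed.

Lemma density_integrable : leb.-integrable I (EFin \o pi).
Proof.
apply/integrableP; split; first by apply/measurable_EFinP; exact: density_measurable.
rewrite (_ : (\int[_]_(_ in _) _)%E = 1%E) ?ltry// -pi_mass.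
by apply: eq_integral => x /[!inE] Ix; rewrite gee0_abs//= lee_fin ltW// pi_gt0.
Qed.

Lemma square_integrable_cst a : L2 (fun=> a).
Proof.
split; first exact: measurable_cst.
exact: (integrable_scale _ mI density_integrable).
Qed.

Lemma square_integrable_comb a u v : L2 u -> L2 v -> L2 (fun x => a * u x + v x).
Proof.
move=> /[dup] Lu [mu iu] /[dup] Lv [mv iv]; split.
  by apply: measurable_funD => //; apply: measurable_funM.
rewrite (_ : (fun _ => _) = EFin \o (fun x => (2 * a) * (u x * v x * pi x) +
   (a ^+ 2 * (u x ^+ 2 * pi x) + v x ^+ 2 * pi x))).
  by apply: integrable_comb => //; [exact: square_integrable_mul|exact: integrable_comb].
by apply/funext => x /=; congr EFin; ring.
Qed.

Lemma square_integrable_norm u : L2 u -> L2 (fun x => `|u x|).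
Proof.
move=> [mu iu]; split; first exact: measurableT_comp.
by under eq_fun do rewrite real_normK ?num_real//.
Qed.

Lemma L2_productC u v : L2_product u v = L2_product v u.
Proof. by rewrite /L2_product; under eq_Rintegral do rewrite (mulrC (u _)). Qed.

Lemma L2_product_combl a u v w : L2 u -> L2 v -> L2 w ->
  L2_product (fun x => a * u x + v x) w = a * L2_product u w + L2_product v w.
Proof.
move=> Lu Lv Lw; rewrite /L2_product -Rintegral_comb//; try exact: square_integrable_mul.
by apply: eq_Rintegral => x _; ring.
Qed.

Lemma L2_product_ge0 u : 0 <= L2_product u u.
Proof.
by apply: Rintegral_ge0 => x Ix; rewrite mulr_ge0 -?expr2 ?sqr_ge0// ltW ?pi_gt0.
Qed.

Lemma norm2_sqE u : norm2_sq x1 x2 pi u = L2_product u u.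
Proof. by []. Qed.

(* A function whose increments are controlled by an integrable tail decays at the
   ends faster than any [N] in L^2 may grow: evaluate it where [N] nearly attains
   its infimum over the tail. *)
Lemma boundary_decay (F h N : R -> R) (c0 d0 e : R) :
  L2 h -> L2 N -> (forall x, I x -> 0 <= h x) -> (forall x, I x -> 1 <= N x) ->
  (forall x y, I x -> I y -> x <= y ->
    `|F y - F x| <= \int[leb]_(z in `[x, y]) (h z * pi z)) ->
  F x @[x --> lower_end x1] --> 0 -> F x @[x --> upper_end x2] --> 0 ->
  I c0 -> I d0 -> 0 < e ->
  exists c d, [/\ I c /\ I d, c <= c0, d0 <= d, `|F c| * N c <= e & `|F d| * N d <= e].
Proof.
move=> Lh LN h0 N1 FH Fl Fu Ic0 Id0 e0.
have e40 : 0 < e / 4 by rewrite divr_gt0.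
have iW := square_integrable_mul Lh LN.
have ihpi : leb.-integrable I (EFin \o (fun z => h z * pi z)).
  have := square_integrable_mul Lh (square_integrable_cst 1).
  by under eq_fun do rewrite mulr1.
have [|c1 [d1 [Ic1 Id1 cd1 tail]]] := integral_tail x12 e40 iW.
  move=> x Ix; rewrite !mulr_ge0 ?h0// ?(le_trans ler01 (N1 _ Ix))//.
  exact/ltW/pi_gt0.
have Nnear (D : set R) : D !=set0 -> D `<=` I -> exists2 d, D d &
    forall z, D z -> N d <= 2 * N z.
  move=> [x0 Dx0] DI; pose A := [set N z | z in D].
  have hA : has_inf A.
    split; first by exists (N x0), x0.
    by exists 1 => _ [z Dz <-]; exact/N1/DI.
  have A1 : 1 <= inf A.
    by apply: lb_le_inf; [exists (N x0), x0|move=> _ [z Dz <-]; exact/N1/DI].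
  (* As inf A >= 1, a value below inf A + 1 is at most twice the infimum. *)
  have [|_ [d Dd <-] Nd] := @inf_adherent _ A 1 _ hA; first by [].
  exists d => // z Dz; rewrite (le_trans (ltW Nd))//.
  have : inf A <= N z by apply: ge_inf; [case: hA|exists z].
  lra.
(* Since N d <= 2 N z on [x, y], the factor N d moves inside the integral of h pi, and the tail of h
   N pi, at most e / 4, gives e / 2. *)
have bound x y d : I x -> I y -> x <= y -> I d ->
    (forall z, x <= z <= y -> N d <= 2 * N z) ->
    y <= c1 \/ d1 <= x -> `|F y - F x| * N d <= e / 2.
  move=> Ix Iy xy Id Nd out.
  have N0 : 0 <= N d by exact: le_trans (N1 _ Id).
  apply: le_trans (ler_wpM2r N0 (FH _ _ Ix Iy xy)) _.
  rewrite mulrC -RintegralZl//; last exact: integrable_itvcc ihpi.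
  apply: (@le_trans _ _ (\int[leb]_(z in `[x, y]) (2 * (h z * N z * pi z)))).
    apply: le_Rintegral; first exact: measurable_itv.
    - apply: integrable_scale; first exact: measurable_itv.
      exact: integrable_itvcc ihpi.
    - apply: integrable_scale; first exact: measurable_itv.
      exact: integrable_itvcc iW.
    move=> z zxy; have Iz := itvcc_state_space Ix Iy zxy.
    move: zxy; rewrite /= in_itv/= => /Nd Ndz.
    have -> : 2 * (h z * N z * pi z) = 2 * N z * (h z * pi z) by ring.
    by rewrite ler_wpM2r// mulr_ge0 ?h0// ltW// pi_gt0.
  rewrite RintegralZl//; last exact: integrable_itvcc iW.
  have := tail _ _ Ix Iy xy out; lra.
(* With d fixed, y will be taken so close to the end that F y is small compared with 1 / N d. *)
have small d (D : set R) : I d -> (exists2 y, D y & `|F y| <= e / 2 / N d) ->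
    (forall y, D y -> `|F y - F d| * N d <= e / 2) -> `|F d| * N d <= e.
  move=> Id [y Dy Fy] /(_ _ Dy) H.
  have N0 : 0 < N d by exact: lt_le_trans (N1 _ Id).
  move: Fy; rewrite ler_pdivlMr// => Fy.
  have := ler_wpM2r (ltW N0) (ler_normB (F y) (F y - F d)).
  rewrite opprB addrC subrK mulrDl; lra.
have [c [Ic cc0 Fc]] : exists c, [/\ I c, c <= c0 & `|F c| * N c <= e].
  pose D := [set z | I z /\ z <= Num.min c0 c1].
  have [||c [Ic cc] Nc] := Nnear D.
  - by exists (Num.min c0 c1); split => //; exact: state_space_min.
  - by move=> z [].
  exists c; split => //; first by rewrite (le_trans cc)// ge_min lexx.
  have N0 : 0 < N c by exact: lt_le_trans (N1 _ Ic).
  apply: (small _ [set y | I y /\ y <= c]) => //.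
  - have [|c' Ic' Hc'] := (lower_end_cvg0P F Ic).1 Fl (e / 2 / N c).
      by rewrite !divr_gt0.
    exists (Num.min c c').
      by split; [exact: state_space_min|rewrite ge_min lexx].
    by apply: Hc'; [exact: state_space_min|rewrite ge_min lexx orbT].
  - move=> y [Iy yc]; rewrite distrC; apply: bound => //.
      move=> z /andP[yz zc]; apply: Nc; split; last exact: le_trans cc.
      by apply: (state_space_itv Iy Ic); rewrite yz.
    by left; rewrite (le_trans cc)// ge_min lexx orbT.
have [d [Id d0d Fd]] : exists d, [/\ I d, d0 <= d & `|F d| * N d <= e].
  pose D := [set z | I z /\ Num.max d0 d1 <= z].
  have [||d [Id dd] Nd] := Nnear D.
  - by exists (Num.max d0 d1); split => //; exact: state_space_max.
  - by move=> z [].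
  exists d; split => //; first by rewrite (le_trans _ dd)// le_max lexx.
  have N0 : 0 < N d by exact: lt_le_trans (N1 _ Id).
  apply: (small _ [set y | I y /\ d <= y]) => //.
  - have [|d' Id' Hd'] := (upper_end_cvg0P F Id).1 Fu (e / 2 / N d).
      by rewrite !divr_gt0.
    exists (Num.max d d').
      by split; [exact: state_space_max|rewrite le_max lexx].
    by apply: Hd'; [exact: state_space_max|rewrite le_max lexx orbT].
  - move=> y [Iy dy]; apply: bound => //.
      move=> z /andP[dz zy]; apply: Nd; split; last exact: le_trans dz.
      by apply: (state_space_itv Id Iy); rewrite dz.
    by right; rewrite (le_trans _ dd)// le_max lexx orbT.
by exists c, d.
Qed.

End weighted_space.

(** * The Sturm-Liouville operator: symmetry and spectral gap *)

Section sturm_liouville.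
Context {R : realType} (x1 x2 : \bar R) (pi sigma : R -> R).
Notation leb := (@lebesgue_measure R).
Notation I := (state_space x1 x2).
Notation L2 := (square_integrable x1 x2 pi).
Notation F := (flux pi sigma).
Notation ip := (L2_product x1 x2 pi).
Implicit Types (u v w h k g : R -> R).

Hypothesis x12 : (x1 < x2)%E.
Hypothesis pi_gt0 : forall x, I x -> 0 < pi x.
Hypothesis pi_continuous : forall x, I x -> {for x, continuous pi}.
Hypothesis pi_mass : (\int[leb]_(x in I) (pi x)%:E = 1)%E.
Hypothesis sigma_neq0 : forall x, I x -> sigma x != 0.

Definition continuous_on_state_space h := forall x, I x -> {for x, continuous h}.

Definition continuous_L2 h := L2 h /\ continuous_on_state_space h.

(* Restricting the operator to continuous right-hand sides makes fluxes
   continuously differentiable; resolvents preserve this restriction. *)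
Definition continuous_SL_graph u h :=
  SL_graph x1 x2 pi sigma u h /\ continuous_on_state_space h.

Let mI : measurable I. Proof. exact: state_space_measurable. Qed.

Lemma variance_density_gt0 x : I x -> 0 < 2^-1 * sigma x ^+ 2 * pi x.
Proof.
move=> Ix; rewrite mulr_gt0 ?pi_gt0// mulr_gt0 ?invr_gt0//.
by rewrite exprn_even_gt0//= sigma_neq0.
Qed.

Lemma SL_graph_derive u h x : SL_graph x1 x2 pi sigma u h -> I x ->
  is_derive x (1 : R) u (derive1 u x).
Proof. by move=> [_ _ du _ _] Ix; apply: is_derive_derive1; exact: du. Qed.

Lemma SL_graph_continuous u h : SL_graph x1 x2 pi sigma u h ->
  continuous_on_state_space u.
Proof. by move=> uh x Ix; exact: is_derive_continuous (SL_graph_derive uh Ix). Qed.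

Lemma weighted_integrable h : L2 h -> leb.-integrable I (EFin \o (fun x => h x * pi x)).
Proof.
move=> Lh; have := square_integrable_mul pi_continuous Lh
  (square_integrable_cst pi_gt0 pi_continuous pi_mass 1).
by under eq_fun do rewrite mulr1.
Qed.

Lemma flux_increment u h x y : SL_graph x1 x2 pi sigma u h -> I x -> I y -> x <= y ->
  F u y - F u x = - \int[leb]_(z in `[x, y]) (h z * pi z).
Proof.
move=> [_ _ _ uh _] Ix Iy; rewrite le_eqVlt => /predU1P[<-|xy].
  by rewrite set_itv1 Rintegral_set1 subrr oppr0.
exact: uh.
Qed.

Lemma flux_increment_le u h x y : SL_graph x1 x2 pi sigma u h ->
  I x -> I y -> x <= y ->
  `|F u y - F u x| <= \int[leb]_(z in `[x, y]) (`|h z| * pi z).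
Proof.
move=> /[dup] uh [_ Lh _ _ _] Ix Iy xy; rewrite (flux_increment uh)// normrN.
have ih : leb.-integrable `[x, y] (EFin \o (fun x => h x * pi x)).
  exact: (integrable_itvcc Ix Iy (weighted_integrable Lh)).
apply: le_trans (le_normr_Rintegral _ ih) _ => //.
rewrite le_eqVlt; apply/predU1P; left; apply: eq_Rintegral => z.
rewrite inE => /(itvcc_state_space Ix Iy) Iz.
by rewrite normrM (gtr0_norm (pi_gt0 Iz)).
Qed.

(** Points c and d that serve all the boundary terms of integration by parts at once:
    [boundary_decay] is applied to |F u| + |F v| with the weight |u| + |v| + 1, and each of the four
    products is bounded by the product of these sums. *)
Lemma SL_graph_boundary u h v k c0 d0 e :
  SL_graph x1 x2 pi sigma u h -> SL_graph x1 x2 pi sigma v k ->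
  I c0 -> I d0 -> 0 < e ->
  exists c d, [/\ I c, I d, c <= c0, d0 <= d &
    `|F u c| * `|v c| <= e /\ `|F u d| * `|v d| <= e /\
    `|F v c| * `|u c| <= e /\ `|F v d| * `|u d| <= e].
Proof.
move=> /[dup] uh [Lu Lh _ _ [Ful Fuu]] /[dup] vk [Lv Lk _ _ [Fvl Fvu]] Ic0 Id0 e0.
pose N x := 1 * `|u x| + (1 * `|v x| + 1).
pose H x := 1 * `|h x| + `|k x|.
pose G x := `|F u x| + `|F v x|.
have nL g : L2 g -> L2 (fun x => `|g x|) by exact: square_integrable_norm.
have LN : L2 N.
  apply: square_integrable_comb => //; first exact: nL.
  apply: square_integrable_comb => //; first exact: nL.
  exact: square_integrable_cst.
have LH : L2 H by apply: square_integrable_comb => //; exact: nL.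
have H0 x : I x -> 0 <= H x by move=> _; rewrite /H mul1r addr_ge0.
have N1 x : I x -> 1 <= N x by move=> _; rewrite /N !mul1r addrA lerDr addr_ge0.
have GH x y : I x -> I y -> x <= y ->
    `|G y - G x| <= \int[leb]_(z in `[x, y]) (H z * pi z).
  move=> Ix Iy xy.
  have ia g : L2 g -> leb.-integrable `[x, y] (EFin \o (fun z => `|g z| * pi z)).
    by move=> Lg; exact: (integrable_itvcc Ix Iy (weighted_integrable (nL _ Lg))).
  have -> : \int[leb]_(z in `[x, y]) (H z * pi z) =
      1 * \int[leb]_(z in `[x, y]) (`|h z| * pi z) +
      \int[leb]_(z in `[x, y]) (`|k z| * pi z).
    rewrite -Rintegral_comb//; [|exact: ia|exact: ia].
    by apply: eq_Rintegral => z _; rewrite /H; ring.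
  have := flux_increment_le uh Ix Iy xy; have := flux_increment_le vk Ix Iy xy.
  have := ler_dist_dist (F u y) (F u x); have := ler_dist_dist (F v y) (F v x).
  have := ler_normD (`|F u y| - `|F u x|) (`|F v y| - `|F v x|).
  rewrite /G opprD addrACA; lra.
have Gl : G x @[x --> lower_end x1] --> 0.
  have PF := lower_end_filter Ic0.
  have FF : Filter (lower_end x1) by exact: filter_filter.
  by have /(_ FF FF FF) := cvgD (cvg_norm Ful) (cvg_norm Fvl); rewrite normr0 addr0.
have Gu : G x @[x --> upper_end x2] --> 0.
  have PF := upper_end_filter Ic0.
  have FF : Filter (upper_end x2) by exact: filter_filter.
  by have /(_ FF FF FF) := cvgD (cvg_norm Fuu) (cvg_norm Fvu); rewrite normr0 addr0.
have [c [d [[Ic Id] cc0 d0d Gc Gd]]] :=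
  boundary_decay x12 pi_gt0 pi_continuous pi_mass LH LN H0 N1 GH Gl Gu Ic0 Id0 e0.
move: Gc Gd; rewrite !ger0_norm ?addr_ge0// => Gc Gd.
have N_ge x : 0 <= `|u x| /\ 0 <= `|v x| by [].
exists c, d; split => //; split; last split; last split.
- apply: le_trans Gc; rewrite /G /N ler_pM ?lerDl//; have [? ?] := N_ge c; lra.
- apply: le_trans Gd; rewrite /G /N ler_pM ?lerDl//; have [? ?] := N_ge d; lra.
- apply: le_trans Gc; rewrite /G /N ler_pM ?lerDr//; have [? ?] := N_ge c; lra.
- apply: le_trans Gd; rewrite /G /N ler_pM ?lerDr//; have [? ?] := N_ge d; lra.
Qed.

Lemma continuous_SL_graph_flux_derive u h x : continuous_SL_graph u h -> I x ->
  is_derive x (1 : R) (F u) (- (h x * pi x)).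
Proof.
move=> [uh ch] Ix; have [c Ic cx] := state_space_lt_ex Ix.
apply: (@is_derive_Rintegral _ x1 x2 (fun x => - (h x * pi x)) x c) => //.
- by move=> y Iy; apply: continuousN; apply: continuousM; [exact: ch|exact: pi_continuous].
- move=> y Iy cy; have := flux_increment uh Ic Iy (ltW cy).
  move=> /eqP; rewrite subr_eq addrC => /eqP ->; congr (_ + _).
  rewrite -mulN1r -RintegralZl//.
    by apply: eq_Rintegral => z _; rewrite mulN1r.
  have [_ Lh _ _ _] := uh.
  exact: (integrable_itvcc Ic Iy (weighted_integrable Lh)).
Qed.

(** Lagrange's identity: the Wronskian W = (F v) u - (F u) v has derivative (h v - u k) pi, and its
    boundary values are negligible. *)
Lemma continuous_SL_graph_sym u h v k :
  continuous_SL_graph u h -> continuous_SL_graph v k -> ip h v = ip u k.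
Proof.
move=> uh vk; have [[Lu Lh _ _ _] ch] := uh; have [[Lv Lk _ _ _] ck] := vk.
pose f x := (-1) * (u x * k x * pi x) + h x * v x * pi x.
have iuk := square_integrable_mul pi_continuous Lu Lk.
have ihv := square_integrable_mul pi_continuous Lh Lv.
have intf : leb.-integrable I (EFin \o f) by exact: integrable_comb.
suff : `|\int[leb]_(x in I) f x| = 0.
  move=> /normr0_eq0; rewrite /f Rintegral_comb// mulN1r => /eqP.
  by rewrite addrC subr_eq0 => /eqP.
apply/eqP; rewrite eq_le normr_ge0 andbT; apply/ler_addgt0Pl => e e0; rewrite addr0.
(* One fifth for the truncation to [c, d], four for the boundary products. *)
have e50 : 0 < e / 5 by rewrite divr_gt0.
have [c0 [d0 [Ic0 Id0 cd0 ex]]] := integral_exhaustion_norm x12 e50 intf.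
have [c [d [Ic Id cc0 d0d [Buc [Bud [Bvc Bvd]]]]]] :=
  SL_graph_boundary uh.1 vk.1 Ic0 Id0 e50.
have := ex c d Ic Id cc0 d0d.
pose W x := F v x * u x - F u x * v x.
have cd : c <= d by rewrite (le_trans cc0)// (le_trans cd0).
have -> : \int[leb]_(x in `[c, d]) f x = W d - W c.
  apply: Rintegral_derive Ic Id cd _ _.
  - move=> x Ix.
    have dFu := continuous_SL_graph_flux_derive uh Ix.
    have dFv := continuous_SL_graph_flux_derive vk Ix.
    have du := SL_graph_derive uh.1 Ix; have dv := SL_graph_derive vk.1 Ix.
    have := is_deriveB (is_deriveM dFv du) (is_deriveM dFu dv).
    rewrite /GRing.scale/= => dW; suff -> : f x = F v x * derive1 u x +
      u x * - (k x * pi x) - (F u x * derive1 v x + v x * - (h x * pi x)) by [].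
    rewrite /f /flux; ring.
  - have cu := SL_graph_continuous uh.1; have cv := SL_graph_continuous vk.1.
    move=> x Ix; apply: continuousD; apply: continuousM => //; try exact: cst_continuous.
    + by apply: continuousM; [apply: continuousM; [exact: cu|exact: ck]|exact: pi_continuous].
    + by apply: continuousM; [exact: ch|exact: cv].
    + exact: pi_continuous.
rewrite /W => H.
move: Buc Bud Bvc Bvd; rewrite -!normrM; move: H; rewrite !ler_norml.
move=> /andP[? ?] /andP[? ?] /andP[? ?] /andP[? ?] /andP[? ?].
by apply/andP; split; lra.
Qed.

Lemma flux_comb a u v x : derivable u x 1 -> derivable v x 1 ->
  F (fun x => a * u x + v x) x = a * F u x + F v x.
Proof.
move=> /is_derive_derive1 du /is_derive_derive1 dv.
have d : is_derive x (1 : R) (fun x => a * u x + v x) (a * derive1 u x + derive1 v x).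
  by apply: is_deriveD; exact: is_deriveZ.
by rewrite /flux (is_derive_derive1E d); ring.
Qed.

Lemma eq_lower_end_cvg0 (f g : R -> R) : (forall x, I x -> f x = g x) ->
  f x @[x --> lower_end x1] --> 0 -> g x @[x --> lower_end x1] --> 0.
Proof.
move=> fg; have [x0 Ix0] := state_space_nonempty x12.
move=> /(lower_end_cvg0P _ Ix0) H; apply/(lower_end_cvg0P _ Ix0) => e /H[c Ic Hc].
by exists c => // y Iy yc; rewrite -fg//; exact: Hc.
Qed.

Lemma eq_upper_end_cvg0 (f g : R -> R) : (forall x, I x -> f x = g x) ->
  f x @[x --> upper_end x2] --> 0 -> g x @[x --> upper_end x2] --> 0.
Proof.
move=> fg; have [x0 Ix0] := state_space_nonempty x12.
move=> /(upper_end_cvg0P _ Ix0) H; apply/(upper_end_cvg0P _ Ix0) => e /H[c Ic Hc].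
by exists c => // y Iy yc; rewrite -fg//; exact: Hc.
Qed.

Lemma SL_graph_comb a u h v k :
  SL_graph x1 x2 pi sigma u h -> SL_graph x1 x2 pi sigma v k ->
  SL_graph x1 x2 pi sigma (fun x => a * u x + v x) (fun x => a * h x + k x).
Proof.
move=> [Lu Lh du uh [Ful Fuu]] [Lv Lk dv vk [Fvl Fvu]].
have FE x : I x -> a * F u x + F v x = F (fun x => a * u x + v x) x.
  by move=> Ix; rewrite flux_comb//; [exact: du|exact: dv].
split.
- exact: square_integrable_comb.
- exact: square_integrable_comb.
- by move=> x Ix; apply: derivableD; [apply: derivableZ; exact: du|exact: dv].
- move=> x y Ix Iy xy; rewrite -!FE//.
  have ih : leb.-integrable `[x, y] (EFin \o (fun x => h x * pi x)).
    exact: (integrable_itvcc Ix Iy (weighted_integrable Lh)).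
  have ik : leb.-integrable `[x, y] (EFin \o (fun x => k x * pi x)).
    exact: (integrable_itvcc Ix Iy (weighted_integrable Lk)).
  have -> : \int[leb]_(z in `[x, y]) ((a * h z + k z) * pi z) =
      a * \int[leb]_(z in `[x, y]) (h z * pi z) + \int[leb]_(z in `[x, y]) (k z * pi z).
    by rewrite -Rintegral_comb//; apply: eq_Rintegral => z _; ring.
  have := uh _ _ Ix Iy xy; have := vk _ _ Ix Iy xy.
  move: (\int[_]_(_ in _) _) (\int[_]_(_ in _) _) => A B; nra.
have [x0 Ix0] := state_space_nonempty x12; split.
- have PF := lower_end_filter Ix0; apply: (eq_lower_end_cvg0 FE).
  have FF : Filter (lower_end x1) by exact: filter_filter.
  by rewrite -[0 in X in _ --> X](addr0 0) -{1}(mulr0 a); apply: cvgD Fvl; exact: cvgMl_tmp.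
- have PF := upper_end_filter Ix0; apply: (eq_upper_end_cvg0 FE).
  have FF : Filter (upper_end x2) by exact: filter_filter.
  by rewrite -[0 in X in _ --> X](addr0 0) -{1}(mulr0 a); apply: cvgD Fvu; exact: cvgMl_tmp.
Qed.

Lemma continuous_L2_comb a u v : continuous_L2 u -> continuous_L2 v ->
  continuous_L2 (fun x => a * u x + v x).
Proof.
move=> [Lu cu] [Lv cv]; split; first exact: square_integrable_comb.
move=> x Ix; apply: continuousD; last exact: cv.
by apply: continuousM; [exact: cst_continuous|exact: cu].
Qed.

Lemma continuous_SL_graph_comb a u h v k :
  continuous_SL_graph u h -> continuous_SL_graph v k ->
  continuous_SL_graph (fun x => a * u x + v x) (fun x => a * h x + k x).
Proof.
move=> [uh ch] [vk ck]; split; first exact: SL_graph_comb.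
have [_ Lh _ _ _] := uh; have [_ Lk _ _ _] := vk.
by have [] := continuous_L2_comb a (conj Lh ch) (conj Lk ck).
Qed.

(** The abstract gap on the space of continuous functions of L^2(pi). A solution of Lu = l u + g is
    differentiable, so its right-hand side is continuous whenever g is, and the resolvent hypothesis
    restricts to this space. *)
Theorem convergence_rate_gap lam u h : convergence_rate x1 x2 pi sigma lam ->
  continuous_SL_graph u h -> lam * ip h u <= ip h h.
Proof.
move=> [lam0 _ [e e0 res]]; pose comb a (u v : R -> R) := fun x => a * u x + v x.
apply: (@spectral_gap_le R (R -> R) comb continuous_L2 ip continuous_SL_graph) => //.
- exact: continuous_L2_comb.
- exact: L2_productC.
- by move=> a v w k [Lv _] [Lw _] [Lk _]; exact: L2_product_combl.
- by move=> v; exact: L2_product_ge0.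
- move=> v k [vk ck]; have [Lv Lk _ _ _] := vk.
  by split; split => //; exact: SL_graph_continuous vk.
- by move=> a *; exact: continuous_SL_graph_comb.
- exact: continuous_SL_graph_sym.
move=> l /andP[l0 llam].
have [onto [C bound]] : resolvent_point x1 x2 pi sigma l.
  by apply: res => //; [rewrite (lt_trans llam)// ltrDl|rewrite lt_eqF].
split.
  move=> g [Lg cg]; have [v vg] := onto g Lg; exists v; split => //.
  have [Lv _ _ _ _] := vg.
  have [] // := continuous_L2_comb l (conj Lv (SL_graph_continuous vg)) (conj Lg cg).
exists C => v k [vk _]; have := bound v k vk.
by rewrite !norm2_sqE /comb; under eq_fun do rewrite addrC -mulNr.
Qed.

End sturm_liouville.

(** * Pearson diffusions *)

Section integral_bounds.
Context {R : realType} (x1 x2 : \bar R).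
Notation leb := (@lebesgue_measure R).
Notation I := (state_space x1 x2).
Implicit Types (f : R -> R).

Lemma Rintegral_itvcc_cst (m c d : R) : I c -> I d -> c <= d ->
  \int[leb]_(z in `[c, d]) m = m * (d - c).
Proof.
move=> Ic Id cd; rewrite mulrBr.
apply: (@Rintegral_derive _ x1 x2 (fun x => m * x) (fun=> m)) => //.
- by move=> x _; rewrite -[X in is_derive _ _ _ X]mulr1; exact: is_deriveZ.
- by move=> x _; exact: cst_continuous.
Qed.

Lemma Rintegral_itvcc_ge f (m c d : R) : I c -> I d -> c <= d ->
  leb.-integrable `[c, d] (EFin \o f) -> (forall z, c <= z <= d -> m <= f z) ->
  m * (d - c) <= \int[leb]_(z in `[c, d]) f z.
Proof.
move=> Ic Id cd intf mf; rewrite -(Rintegral_itvcc_cst m Ic Id cd).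
apply: le_Rintegral => //.
by apply: (@continuous_integrable_itvcc _ x1 x2) => // x _; exact: cst_continuous.
Qed.

(** Serves to show that pi has a finite second moment, from a bound over compact intervals obtained
    by integration by parts. *)
Lemma bounded_exhaustion_integrable f (x0 M : R) : I x0 ->
  (forall x, I x -> {for x, continuous f}) -> (forall x, I x -> 0 <= f x) ->
  (forall c d, I c -> I d -> c <= x0 <= d -> \int[leb]_(z in `[c, d]) f z <= M) ->
  leb.-integrable I (EFin \o f).
Proof.
move=> Ix0 cf f0 fM.
have [c [Ic cni cI]] := state_space_lower_seq Ix0.
have [d [Id dnd dI]] := state_space_upper_seq Ix0.
have [n0 cn0] := cI _ Ix0; have [m0 dm0] := dI _ Ix0.
(* The shifts make every interval contain [x0], as the bound [fM] demands. *)
pose F n := `[c (n0 + n)%N, d (m0 + n)%N]%classic.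
have IE : I = \bigcup_n F n.
  apply/seteqP; split => x.
    move=> Ix; have [m cx] := cI _ Ix; have [n xd] := dI _ Ix.
    exists (maxn m n) => //; rewrite /F/= in_itv/=; apply/andP; split.
      by rewrite (le_trans _ cx)// cni// (leq_trans (leq_maxl m n))// leq_addl.
    by rewrite (le_trans xd)// dnd// (leq_trans (leq_maxr m n))// leq_addl.
  by move=> [n _]; exact: itvcc_state_space.
have FI n : F n `<=` I by exact: itvcc_state_space.
have ndF : nondecreasing_seq F.
  move=> m n mn; rewrite subsetEset /F => x /=; rewrite !in_itv/= => /andP[h1 h2].
  rewrite (le_trans (cni _ _ _) h1) ?leq_add2l//.
  by rewrite (le_trans h2 (dnd _ _ _))// leq_add2l.
have cvgF : (\int[leb]_(x in F i) (f x)%:E @[i --> \oo] -->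
    \int[leb]_(x in I) (f x)%:E)%E.
  rewrite IE; apply: ge0_nondecreasing_set_cvg_integral => //.
  - by move=> n; exact: measurable_itv.
  - move=> n; have /integrableP[] // := continuous_integrable_itvcc (Ic (n0 + n)%N) (Id (m0 + n)%N) cf.
  - by move=> n x /FI Ix; rewrite lee_fin f0.
apply/integrableP; split.
  by apply/measurable_EFinP; exact: continuous_measurable_state_space.
rewrite (_ : (\int[_]_(_ in _) _)%E = (\int[leb]_(x in I) (f x)%:E)%E); last first.
  by apply: eq_integral => x /[!inE] Ix; rewrite gee0_abs//= lee_fin f0.
apply: (@le_lt_trans _ _ M%:E); last by rewrite ltry.
rewrite -(cvg_lim _ cvgF)//; apply: lime_le; first by apply/cvg_ex; eexists; exact: cvgF.
apply: nearW => n; have iF := continuous_integrable_itvcc (Ic (n0 + n)%N) (Id (m0 + n)%N) cf.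
rewrite -(@fineK _ (\int[leb]_(x in F n) (f x)%:E)%E).
  rewrite lee_fin; apply: fM => //.
  by rewrite (le_trans (cni _ _ _) cn0) ?leq_addr// (le_trans dm0 (dnd _ _ _))// leq_addr.
by apply: (integrable_fin_num _ iF); exact: measurable_itv.
Qed.

End integral_bounds.

Section pearson.
Context {R : realType} (x1 x2 : \bar R) (pi mu sigma : R -> R).
Notation leb := (@lebesgue_measure R).
Notation I := (state_space x1 x2).
Notation G := (fun x => 2^-1 * sigma x ^+ 2 * pi x).
Notation L2 := (square_integrable x1 x2 pi).

Hypothesis rd : reversible_diffusion x1 x2 pi mu sigma.
Variables p q : {poly R}.
Hypothesis p_size : (size p <= 2)%N.
Hypothesis mu_p : forall x, I x -> mu x = p.[x].
Hypothesis variance_q : forall x, I x -> variance_function sigma x = q.[x].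
Hypothesis q_end : forall a : R, x1 = a%:E \/ x2 = a%:E -> q.[a] = 0.

Let x12 : (x1 < x2)%E. Proof. by case: rd. Qed.
Let pi_gt0 x : I x -> 0 < pi x. Proof. by case: rd => _ H *; exact: H. Qed.
Let pi_continuous x : I x -> {for x, continuous pi}.
Proof. by case: rd => _ _ H *; exact: H. Qed.
Let pi_mass : (\int[leb]_(x in I) (pi x)%:E = 1)%E. Proof. by case: rd. Qed.
Let sigma_neq0 x : I x -> sigma x != 0.
Proof. by case: rd => _ _ _ _ H *; exact: H. Qed.

Let G_gt0 x : I x -> 0 < G x. Proof. exact: variance_density_gt0. Qed.

Let G_integrable : leb.-integrable I (EFin \o G).
Proof. by case: rd. Qed.

Lemma pearson_flux_derive x : I x -> is_derive x (1 : R) G (p.[x] * pi x).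
Proof.
move=> Ix; case: rd => _ _ _ _ _ _ _ /(_ _ Ix) dG /(_ _ Ix) muE.
have := is_derive_derive1 dG; set D := derive1 _ x => dD.
have DE : 2^-1 * D = p.[x] * pi x.
  rewrite -mu_p// muE -/D; field.
  by rewrite gt_eqF// pi_gt0.
rewrite -DE (_ : G = (fun x => 2^-1 * (sigma x ^+ 2 * pi x))).
  exact: is_deriveZ.
by apply/funext => z /=; ring.
Qed.

Let G_continuous x : I x -> {for x, continuous G}.
Proof. by move=> Ix; exact: is_derive_continuous (pearson_flux_derive Ix). Qed.

(* A positive lower bound on G near an infinite end contradicts the finite average
   variance; near a finite end, where q vanishes, it contradicts the finite mass. *)
Lemma pearson_flux_upper d0 e : I d0 -> 0 < e ->
  (forall x, I x -> d0 <= x -> e <= G x) -> False.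
Proof.
move=> Id0 e0 eG; have e20 : 0 < e / 2 by rewrite divr_gt0.
have [x2oo|[b x2b]] : x2 = +oo%E \/ exists b, x2 = b%:E.
  by case: x2 Id0 => [b| |] [_]; [right; exists b|left|rewrite ltNge leNye].
- have [c1 [d1 [Ic1 Id1 _ tail]]] :=
    integral_tail x12 e20 G_integrable (fun x Ix => ltW (G_gt0 Ix)).
  (* Over the unit interval [x, x + 1] the integral of G is at least e, twice what the tail
     allows. *)
  pose x := Num.max d0 d1; have Ix : I x by exact: state_space_max.
  have Iy : I (x + 1).
    split; last by rewrite x2oo ltry.
    by case: Ix => h _; rewrite (lt_trans h)// lte_fin ltrDl.
  have xy : x <= x + 1 by rewrite lerDl.
  have := tail _ _ Ix Iy xy; apply: contraPP => _; apply/not_implyP; split.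
    by right; rewrite le_max lexx orbT.
  apply/negP; rewrite -ltNge.
  have := @Rintegral_itvcc_ge _ _ _ G e x (x + 1) Ix Iy xy.
  have -> : x + 1 - x = 1 by ring.
  rewrite mulr1 => H; apply: lt_le_trans (H _ _).
  + by rewrite ltr_pdivrMr// mulr_natr mulr2n ltrDl.
  + exact: integrable_itvcc G_integrable.
  + move=> z /andP[xz zy]; apply: eG.
      by apply: (state_space_itv Ix Iy); rewrite xz.
    by rewrite (le_trans _ xz)// le_max lexx.
have qb : q.[b] = 0 by apply: q_end; right.
(* Hence q <= (C + 1) (b - x) near b, and pi = G / q is at least of order 1 / (b - x), which is not
   integrable. *)
have [r qE] : exists r : {poly R}, q = r * ('X - b%:P) by apply/factor_theorem/rootP.
have [C HC] := poly_itv_bound r d0 b.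
have d0b : d0 < b by case: Id0 => _; rewrite x2b lte_fin.
have C0 : 0 <= C by apply: le_trans (HC b _); rewrite ?normr_ge0// lexx ltW.
have qC x : d0 <= x <= b -> q.[x] <= (C + 1) * (b - x).
  move=> /[dup] /HC rx /andP[d0x xb].
  rewrite qE hornerM hornerXsubC -opprB mulrN -mulNr ler_wpM2r ?subr_ge0//.
  have := ler_norm (- r.[x]); rewrite normrN; lra.
have C10 : 0 < C + 1 by lra.
pose e' := e / (4 * (C + 1)); have e'0 : 0 < e' by rewrite divr_gt0// mulr_gt0.
have [c1 [d1 [Ic1 Id1 _ tail]]] := integral_tail x12 e'0
  (density_integrable pi_gt0 pi_continuous pi_mass) (fun x Ix => ltW (pi_gt0 Ix)).
pose x := Num.max d0 d1; have Ix : I x by exact: state_space_max.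
have xb : x < b by case: Ix => _; rewrite x2b lte_fin.
(* Between x and this midpoint the mass is at least e / (2 (C + 1)), however close x is to b; this
   is twice the tail [e']. *)
pose y := (x + b) / 2.
have [xy yb] : x < y /\ y < b by rewrite /y !midf_lt.
have Iy : I y.
  split; last by rewrite x2b lte_fin.
  by case: Ix => h _; rewrite (lt_trans h)// lte_fin.
have d0x : d0 <= x by rewrite le_max lexx.
have := tail _ _ Ix Iy (ltW xy); apply: contraPP => _; apply/not_implyP; split.
  by right; rewrite le_max lexx orbT.
apply/negP; rewrite -ltNge.
pose m := e / ((C + 1) * (b - x)).
have Cbx : 0 < (C + 1) * (b - x) by rewrite mulr_gt0// subr_gt0.
apply: (@lt_le_trans _ _ (m * (y - x))).
  have -> : m * (y - x) = e / (2 * (C + 1)).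
    rewrite /m /y; field; rewrite !gt_eqF ?subr_gt0//.
  rewrite /e' ltr_pM2l// ltf_pV2 ?posrE ?mulr_gt0//; lra.
apply: (Rintegral_itvcc_ge Ix Iy (ltW xy)).
  exact: (integrable_itvcc Ix Iy (density_integrable pi_gt0 pi_continuous pi_mass)).
move=> z /andP[xz zy]; have Iz : I z by apply: (state_space_itv Ix Iy); rewrite xz.
rewrite /m ler_pdivrMr//.
have := eG z Iz (le_trans d0x xz) => /le_trans; apply.
have -> : G z = pi z * q.[z] by rewrite -variance_q// /variance_function mulrC.
rewrite ler_pM2l ?pi_gt0//; apply: le_trans (qC _ _) _.
  by rewrite (le_trans d0x xz) (le_trans zy (ltW yb)).
by rewrite ler_pM2l// lerB.
Qed.

Lemma pearson_flux_lower c0 e : I c0 -> 0 < e ->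
  (forall x, I x -> x <= c0 -> e <= G x) -> False.
Proof.
move=> Ic0 e0 eG; have e20 : 0 < e / 2 by rewrite divr_gt0.
have [x1oo|[a x1a]] : x1 = -oo%E \/ exists a, x1 = a%:E.
  by case: x1 Ic0 => [a| |] []; [right; exists a|rewrite ltNge leey|left].
- have [c1 [d1 [Ic1 Id1 _ tail]]] :=
    integral_tail x12 e20 G_integrable (fun x Ix => ltW (G_gt0 Ix)).
  pose x := Num.min c0 c1; have Ix : I x by exact: state_space_min.
  have Iy : I (x - 1).
    split; first by rewrite x1oo ltNyr.
    by case: Ix => _ h; rewrite (lt_trans _ h)// lte_fin ltrBlDr ltrDl.
  have yx : x - 1 <= x by rewrite lerBlDr lerDl.
  have := tail _ _ Iy Ix yx; apply: contraPP => _; apply/not_implyP; split.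
    by left; rewrite ge_min lexx orbT.
  apply/negP; rewrite -ltNge.
  have := @Rintegral_itvcc_ge _ _ _ G e (x - 1) x Iy Ix yx.
  have -> : x - (x - 1) = 1 by ring.
  rewrite mulr1 => H; apply: lt_le_trans (H _ _).
  + by rewrite ltr_pdivrMr// mulr_natr mulr2n ltrDl.
  + exact: integrable_itvcc G_integrable.
  + move=> z /andP[yz zx]; apply: eG.
      by apply: (state_space_itv Iy Ix); rewrite yz.
    by rewrite (le_trans zx)// ge_min lexx.
have qa : q.[a] = 0 by apply: q_end; left.
have [r qE] : exists r : {poly R}, q = r * ('X - a%:P) by apply/factor_theorem/rootP.
have [C HC] := poly_itv_bound r a c0.
have ac0 : a < c0 by case: Ic0; rewrite x1a lte_fin.
have C0 : 0 <= C by apply: le_trans (HC a _); rewrite ?normr_ge0// lexx ltW.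
have qC x : a <= x <= c0 -> q.[x] <= (C + 1) * (x - a).
  move=> /[dup] /HC rx /andP[ax xc0].
  rewrite qE hornerM hornerXsubC ler_wpM2r ?subr_ge0//.
  have := ler_norm r.[x]; lra.
have C10 : 0 < C + 1 by lra.
pose e' := e / (4 * (C + 1)); have e'0 : 0 < e' by rewrite divr_gt0// mulr_gt0.
have [c1 [d1 [Ic1 Id1 _ tail]]] := integral_tail x12 e'0
  (density_integrable pi_gt0 pi_continuous pi_mass) (fun x Ix => ltW (pi_gt0 Ix)).
pose x := Num.min c0 c1; have Ix : I x by exact: state_space_min.
have ax : a < x by case: Ix; rewrite x1a lte_fin.
pose y := (a + x) / 2.
have [ay yx] : a < y /\ y < x by rewrite /y !midf_lt.
have Iy : I y.
  split; first by rewrite x1a lte_fin.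
  by case: Ix => _ h; rewrite (lt_trans _ h)// lte_fin.
have xc0 : x <= c0 by rewrite ge_min lexx.
have := tail _ _ Iy Ix (ltW yx); apply: contraPP => _; apply/not_implyP; split.
  by left; rewrite ge_min lexx orbT.
apply/negP; rewrite -ltNge.
pose m := e / ((C + 1) * (x - a)).
have Cbx : 0 < (C + 1) * (x - a) by rewrite mulr_gt0// subr_gt0.
apply: (@lt_le_trans _ _ (m * (x - y))).
  have -> : m * (x - y) = e / (2 * (C + 1)).
    rewrite /m /y; field; rewrite !gt_eqF ?subr_gt0//.
  rewrite /e' ltr_pM2l// ltf_pV2 ?posrE ?mulr_gt0//; lra.
apply: (Rintegral_itvcc_ge Iy Ix (ltW yx)).
  exact: (integrable_itvcc Iy Ix (density_integrable pi_gt0 pi_continuous pi_mass)).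
move=> z /andP[yz zx]; have Iz : I z by apply: (state_space_itv Iy Ix); rewrite yz.
rewrite /m ler_pdivrMr//.
have := eG z Iz (le_trans zx xc0) => /le_trans; apply.
have -> : G z = pi z * q.[z] by rewrite -variance_q// /variance_function mulrC.
rewrite ler_pM2l ?pi_gt0//; apply: le_trans (qC _ _) _.
  by rewrite (le_trans (ltW ay) yz) (le_trans zx xc0).
by rewrite ler_pM2l// lerB.
Qed.

(** The sign of the drift is that of G'. A nonnegative slope, or a zero of the drift outside the
    state space, would make G grow weakly from some [x0] towards one of the ends, so that [G x0]
    would bound it from below there. *)
Lemma pearson_drift : exists k m, [/\ 0 < k, I m &
  forall x, p.[x] = - (k * (x - m))].
Proof.
have pE x : p.[x] = p`_0 + p`_1 * x.
  by rewrite (horner_coef_wide _ p_size) !big_ord_recl big_ord0 expr0 expr1 mulr1 addr0.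
have [x0 Ix0] := state_space_nonempty x12.
have up x y : I x -> I y -> x <= y -> (forall z, x <= z <= y -> 0 <= p.[z]) -> G x <= G y.
  move=> Ix Iy xy pz; apply: (@is_derive_ge0_le _ G (fun x => p.[x] * pi x)) => // z xzy.
  have Iz := state_space_itv Ix Iy xzy.
  by split; [exact: pearson_flux_derive|rewrite mulr_ge0 ?pz// ltW ?pi_gt0].
have down x y : I x -> I y -> x <= y -> (forall z, x <= z <= y -> p.[z] <= 0) -> G y <= G x.
  move=> Ix Iy xy pz; apply: (@is_derive_le0_ge _ G (fun x => p.[x] * pi x)) => // z xzy.
  have Iz := state_space_itv Ix Iy xzy.
  by split; [exact: pearson_flux_derive|rewrite mulr_le0_ge0 ?pz// ltW ?pi_gt0].
have b_lt0 : p`_1 < 0.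
  rewrite ltNge; apply/negP => b0.
  have [a0|a0] := leP 0 p.[x0].
    apply: (pearson_flux_upper Ix0 (G_gt0 Ix0)) => y Iy xy.
    apply: up => // z /andP[xz _]; apply: le_trans a0 _.
    by rewrite !pE lerD2l ler_wpM2l.
  apply: (pearson_flux_lower Ix0 (G_gt0 Ix0)) => y Iy yx.
  apply: down => // z /andP[_ zx]; apply: le_trans (ltW a0).
  by rewrite !pE lerD2l ler_wpM2l.
pose k := - p`_1; pose m := p`_0 / k.
have k0 : 0 < k by rewrite oppr_gt0.
have pkm x : p.[x] = - (k * (x - m)).
  by rewrite pE /m /k; field; rewrite lt_eqF.
exists k, m; split => //.
have [xm|mx] := leP x0 m.
  have [[y [Iy my]]|H] := pselect (exists y, I y /\ m <= y).
    by apply: (state_space_itv Ix0 Iy); rewrite xm.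
  exfalso; apply: (pearson_flux_upper Ix0 (G_gt0 Ix0)) => y Iy xy.
  apply: up => // z /andP[xz zy].
  have zm : z <= m.
    rewrite leNgt; apply/negP => mz; apply: H; exists z; split; last exact: ltW.
    by apply: (state_space_itv Ix0 Iy); rewrite xz.
  by rewrite pkm -mulrN mulr_ge0 ?(ltW k0)// opprB subr_ge0.
have [[y [Iy ym]]|H] := pselect (exists y, I y /\ y <= m).
  by apply: (state_space_itv Iy Ix0); rewrite ym ltW.
exfalso; apply: (pearson_flux_lower Ix0 (G_gt0 Ix0)) => y Iy yx.
apply: down => // z /andP[yz zx].
have mz : m <= z.
  rewrite leNgt; apply/negP => zm; apply: H; exists z; split; last exact: ltW.
  by apply: (state_space_itv Iy Ix0); rewrite yz.
by rewrite pkm oppr_le0 mulr_ge0 ?(ltW k0)// subr_ge0.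
Qed.

(** G is monotone on either side of its maximum at m, and cannot stay above a positive constant near
    an end; hence G tends to 0, which is the reflecting condition for x - m. The variance is then
    compared with the average variance by integration by parts. *)
Lemma pearson_linear_eigenfunction : exists k m, [/\ 0 < k, I m,
  forall x, I x -> is_derive x (1 : R) G (- (k * (x - m) * pi x)),
  SL_graph x1 x2 pi sigma (fun x => x - m) (fun x => k * (x - m)) &
  average_variance x1 x2 pi sigma <=
    k * L2_product x1 x2 pi (fun x => x - m) (fun x => x - m)].
Proof.
have [k [m [k0 Im pE]]] := pearson_drift; exists k, m.
have dG x : I x -> is_derive x (1 : R) G (- (k * (x - m) * pi x)).
  by move=> Ix; rewrite -mulNr -pE; exact: pearson_flux_derive.
pose l x := x - m; have cl : continuous l.
  by move=> x; apply: continuousB; [exact: cvg_id|exact: cst_continuous].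
have dl x : is_derive x (1 : R) l 1.
  by rewrite -[X in is_derive _ _ _ X]subr0; apply: is_deriveB.
have G_down x y : I x -> I y -> m <= x -> x <= y -> G y <= G x.
  move=> Ix Iy mx xy.
  apply: (@is_derive_le0_ge _ G (fun x => - (k * (x - m) * pi x))) => // z xzy.
  have Iz := state_space_itv Ix Iy xzy; split; first exact: dG.
  rewrite oppr_le0 !mulr_ge0// ?(ltW k0)// ?(ltW (pi_gt0 Iz))// subr_ge0.
  by case/andP: xzy => xz _; exact: le_trans xz.
have G_up x y : I x -> I y -> y <= m -> x <= y -> G x <= G y.
  move=> Ix Iy ym xy.
  apply: (@is_derive_ge0_le _ G (fun x => - (k * (x - m) * pi x))) => // z xzy.
  have Iz := state_space_itv Ix Iy xzy; split; first exact: dG.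
  rewrite oppr_ge0 mulr_le0_ge0// ?(ltW (pi_gt0 Iz))// mulr_ge0_le0 ?(ltW k0)//.
  by rewrite subr_le0; case/andP: xzy => _ zy; exact: le_trans zy ym.
have Gu : G x @[x --> upper_end x2] --> 0.
  apply/(upper_end_cvg0P _ Im) => e e0.
  have [[d [Id md Gd]]|H] := pselect (exists d, [/\ I d, m <= d & G d <= e]).
    exists d => // y Iy dy; rewrite gtr0_norm ?G_gt0//.
    by apply: le_trans (G_down _ _ Id Iy md dy) _.
  exfalso; apply: (pearson_flux_upper Im e0) => x Ix mx.
  by rewrite leNgt; apply/negP => /ltW ?; apply: H; exists x.
have Gl : G x @[x --> lower_end x1] --> 0.
  apply/(lower_end_cvg0P _ Im) => e e0.
  have [[c [Ic cm Gc]]|H] := pselect (exists c, [/\ I c, c <= m & G c <= e]).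
    exists c => // y Iy yc; rewrite gtr0_norm ?G_gt0//.
    by apply: le_trans (G_up _ _ Iy Ic cm yc) _.
  exfalso; apply: (pearson_flux_lower Im e0) => x Ix mx.
  by rewrite leNgt; apply/negP => /ltW ?; apply: H; exists x.
pose A := average_variance x1 x2 pi sigma.
have AE : A = \int[leb]_(x in I) G x by [].
(* Integrated form of (l G)' = G - k l^2 pi. *)
have parts c d : I c -> I d -> c <= d ->
    \int[leb]_(x in `[c, d]) (l x * l x * pi x) =
    k^-1 * (\int[leb]_(x in `[c, d]) G x - (l d * G d - l c * G c)).
  move=> Ic Id cd.
  have dlG x : I x -> is_derive x (1 : R) (fun x => l x * G x)
      (G x + (- k) * (l x * l x * pi x)).
    move=> Ix; have := is_deriveM (dl x) (dG x Ix); rewrite /GRing.scale/=.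
    move=> dlG; suff <- : l x * - (k * (x - m) * pi x) + G x * 1 =
      G x + (- k) * (l x * l x * pi x) by [].
    by rewrite /l; ring.
  have cll x : I x -> {for x, continuous (fun x => l x * l x * pi x)}.
    move=> Ix; apply: continuousM; last exact: pi_continuous.
    by apply: continuousM; exact: cl.
  have := Rintegral_derive Ic Id cd dlG.
  have iG : leb.-integrable `[c, d] (EFin \o G) by exact: integrable_itvcc G_integrable.
  have ill : leb.-integrable `[c, d] (EFin \o (fun x => l x * l x * pi x)).
    exact: (continuous_integrable_itvcc Ic Id cll).
  under eq_Rintegral do rewrite addrC.
  rewrite Rintegral_comb// => <-; last first.
    move=> x Ix; apply: continuousD; first exact: G_continuous.
    by apply: continuousM; [exact: cst_continuous|exact: cll].
  by field; rewrite gt_eqF.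
have Ll : L2 l.
  split; first by apply: continuous_measurable_state_space => x _; exact: cl.
  apply: (@bounded_exhaustion_integrable _ x1 x2 _ m (k^-1 * A)) => //.
  - move=> x Ix; apply: continuousM; last exact: pi_continuous.
    by apply: continuousM; exact: cl.
  - by move=> x Ix; rewrite mulr_ge0 ?sqr_ge0// ltW ?pi_gt0.
  move=> c d Ic Id /andP[cm md].
  rewrite parts//; last exact: le_trans md.
  rewrite ler_pM2l ?invr_gt0// lerBlDr.
  have GA := Rintegral_itvcc_le Ic Id G_integrable (fun x Ix => ltW (G_gt0 Ix)).
  apply: le_trans GA _; rewrite -AE lerDl subr_ge0 (@le_trans _ _ 0)//.
    by rewrite mulr_le0_ge0 ?subr_le0// ltW// G_gt0.
  by rewrite mulr_ge0 ?subr_ge0// ltW// G_gt0.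
have graph : SL_graph x1 x2 pi sigma l (fun x => k * l x).
  have fluxE : flux pi sigma l = G.
    by apply/funext => x; rewrite /flux (is_derive_derive1E (dl x)) mulr1.
  split => //.
  - have := square_integrable_comb pi_continuous k Ll
      (square_integrable_cst pi_gt0 pi_continuous pi_mass 0).
    by under eq_fun do rewrite addr0.
  - move=> x y Ix Iy xy; rewrite fluxE.
    rewrite -(Rintegral_derive Ix Iy (ltW xy) dG).
      rewrite -[RHS]mulN1r -RintegralZl//.
        by apply: eq_Rintegral => z _; rewrite mulN1r.
      apply: (@continuous_integrable_itvcc _ x1 x2) => // z Iz.
      apply: continuousM; last exact: pi_continuous.
      by apply: continuousM; [exact: cst_continuous|exact: cl].
    move=> z Iz; apply: continuousN; apply: continuousM; last exact: pi_continuous.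
    by apply: continuousM; [exact: cst_continuous|exact: cl].
  - by rewrite /reflecting fluxE.
split => //; rewrite -/A -/l.
(* With l now in L^2(pi), [SL_graph_boundary] makes l G small at both ends: two thirds of the error,
   the last one being the truncation of the average variance. *)
apply/ler_addgt0Pr => e e0; have e30 : 0 < e / 3 by rewrite divr_gt0.
have [c0 [d0 [Ic0 Id0 cd0 ex]]] := integral_exhaustion x12 e30 G_integrable
  (fun x Ix => ltW (G_gt0 Ix)).
have [c [d [Ic Id cc0 d0d [_ [_ [Bc Bd]]]]]] :=
  SL_graph_boundary x12 pi_gt0 pi_continuous pi_mass graph graph Ic0 Id0 e30.
have := ex c d Ic Id cc0 d0d; rewrite -AE.
have cd : c <= d by rewrite (le_trans cc0)// (le_trans cd0).
have := parts c d Ic Id cd => /(congr1 ( *%R k)); rewrite mulrA divff ?gt_eqF// mul1r.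
have Vle : \int[leb]_(x in `[c, d]) (l x * l x * pi x) <= L2_product x1 x2 pi l l.
  apply: (Rintegral_itvcc_le Ic Id); first by case: Ll.
  by move=> x Ix; rewrite mulr_ge0 -?expr2 ?sqr_ge0// ltW ?pi_gt0.
have := ler_wpM2l (ltW k0) Vle.
move: Bc Bd; rewrite /flux !(is_derive_derive1E (dl _)) !mulr1 -!normrM !ler_norml.
move=> /andP[? ?] /andP[? ?] ? ? ?; lra.
Qed.

End pearson.

(** When F = G phi', the function is k F (phi - (x - m) phi'), which vanishes identically for phi =
    x - m. *)
Lemma is_derive_lyapunov {R : realType} (k m : R) (F G phi : R -> R) (x f g p : R) :
  is_derive x (1 : R) F f -> is_derive x (1 : R) G g -> is_derive x (1 : R) phi p ->
  G x != 0 ->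
  is_derive x (1 : R)
    (fun x => - (k * (x - m) * (F x ^+ 2 / G x)) + k * (F x * phi x))
    (- (k * (F x ^+ 2 / G x) +
        k * (x - m) * (2 * F x * f / G x - F x ^+ 2 * g / G x ^+ 2)) +
     k * (f * phi x + F x * p)).
Proof.
move=> dF dG dphi Gn.
have dl : is_derive x (1 : R) (fun x => k * (x - m)) k.
  rewrite -[X in is_derive _ _ _ X]mulr1; apply: is_deriveZ.
  by rewrite -[X in is_derive _ _ _ X]subr0; apply: is_deriveB.
have dV := is_deriveV Gn dG.
have H := is_deriveD (is_deriveN (is_deriveM dl (is_deriveM (is_deriveM dF dF) dV)))
  (is_deriveZ k (is_deriveM dF dphi)).
apply: (is_derive_eq H); rewrite /GRing.scale/= !mulrfctE.
by field.
Qed.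

(** * Absence of eigenvalues strictly between 0 and k *)

Section first_eigenvalue.
Context {R : realType} (x1 x2 : \bar R) (pi sigma : R -> R).
Notation leb := (@lebesgue_measure R).
Notation I := (state_space x1 x2).
Notation G := (fun x => 2^-1 * sigma x ^+ 2 * pi x).

Hypothesis x12 : (x1 < x2)%E.
Hypothesis pi_gt0 : forall x, I x -> 0 < pi x.
Hypothesis pi_continuous : forall x, I x -> {for x, continuous pi}.
Hypothesis pi_mass : (\int[leb]_(x in I) (pi x)%:E = 1)%E.
Hypothesis sigma_neq0 : forall x, I x -> sigma x != 0.
Variables k m : R.
Hypothesis k_gt0 : 0 < k.
Hypothesis Im : I m.
Hypothesis dG : forall x, I x -> is_derive x (1 : R) G (- (k * (x - m) * pi x)).

Variables (lam : R) (phi : R -> R).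
Hypothesis lam_gt0 : 0 < lam.
Hypothesis phi_eigen : eigenfunction x1 x2 pi sigma lam phi.

Notation F := (flux pi sigma phi).

Let G_gt0 x : I x -> 0 < G x. Proof. exact: variance_density_gt0. Qed.

Lemma eigenfunction_derive x : I x -> is_derive x (1 : R) phi (F x / G x).
Proof.
move=> Ix; have [_ _ /(_ _ Ix) dphi _ _] := phi_eigen.
rewrite /flux mulrAC divff ?mul1r ?gt_eqF ?G_gt0//.
exact: is_derive_derive1.
Qed.

Let phi_continuous x : I x -> {for x, continuous phi}.
Proof. by move=> Ix; exact: is_derive_continuous (eigenfunction_derive Ix). Qed.

Lemma eigenfunction_flux_derive x : I x -> is_derive x (1 : R) F (- (lam * phi x * pi x)).
Proof.
move=> Ix; have [_ _ _ /(_ _ Ix) [dF /eqP]] := phi_eigen.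
rewrite addr_eq0 => /eqP E _; rewrite mulrAC -E.
exact: is_derive_derive1.
Qed.

Let lam_phi_pi_continuous x : I x -> {for x, continuous (fun x => lam * phi x * pi x)}.
Proof.
move=> Ix; apply: continuousM; last exact: pi_continuous.
by apply: continuousM; [exact: cst_continuous|exact: phi_continuous].
Qed.

Lemma eigenfunction_SL_graph : SL_graph x1 x2 pi sigma phi (fun x => lam * phi x).
Proof.
have [Lphi _ dphi _ refl] := phi_eigen; split => //.
  have := square_integrable_comb pi_continuous lam Lphi
    (square_integrable_cst pi_gt0 pi_continuous pi_mass 0).
  by under eq_fun do rewrite addr0.
move=> x y Ix Iy xy.
rewrite -(Rintegral_derive Ix Iy (ltW xy) eigenfunction_flux_derive).
  rewrite -[RHS]mulN1r -RintegralZl//.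
    by apply: eq_Rintegral => z _; rewrite mulN1r.
  exact: (continuous_integrable_itvcc Ix Iy lam_phi_pi_continuous).
by move=> z Iz; apply: continuousN; exact: lam_phi_pi_continuous.
Qed.

(** Cauchy-Schwarz for the weight pi, applied to F' = -lam phi pi: the discriminant of the integral
    of (phi - t)^2 pi. *)
Lemma eigenfunction_flux_increment x y : I x -> I y -> x <= y ->
  (F y - F x) ^+ 2 <= lam ^+ 2 * \int[leb]_(z in `[x, y]) (phi z ^+ 2 * pi z) *
    \int[leb]_(z in `[x, y]) pi z.
Proof.
move=> Ix Iy xy.
have cpp z : I z -> {for z, continuous (fun z => phi z * pi z)}.
  by move=> Iz; apply: continuousM; [exact: phi_continuous|exact: pi_continuous].
have cpp2 z : I z -> {for z, continuous (fun z => phi z ^+ 2 * pi z)}.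
  move=> Iz; apply: continuousM; last exact: pi_continuous.
  by apply: continuousM; exact: phi_continuous.
have i0 := continuous_integrable_itvcc Ix Iy pi_continuous.
have i1 := continuous_integrable_itvcc Ix Iy cpp.
have i2 := continuous_integrable_itvcc Ix Iy cpp2.
have -> : F y - F x = - (lam * \int[leb]_(z in `[x, y]) (phi z * pi z)).
  rewrite (flux_increment eigenfunction_SL_graph Ix Iy xy); congr (- _).
  by rewrite -RintegralZl//; apply: eq_Rintegral => z _; ring.
rewrite sqrrN exprMn -mulrA ler_wpM2l ?sqr_ge0//.
apply: quadratic_ge0_discriminant.
  by apply: Rintegral_ge0 => z /(itvcc_state_space Ix Iy) Iz; rewrite ltW// pi_gt0.
move=> t; have -> : \int[leb]_(z in `[x, y]) (phi z ^+ 2 * pi z) -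
    2 * t * \int[leb]_(z in `[x, y]) (phi z * pi z) +
    t ^+ 2 * \int[leb]_(z in `[x, y]) pi z =
    \int[leb]_(z in `[x, y]) ((- (2 * t)) * (phi z * pi z) +
      (t ^+ 2 * pi z + phi z ^+ 2 * pi z)).
  rewrite !Rintegral_comb//; last by apply: integrable_comb.
  ring.
apply: Rintegral_ge0 => z /(itvcc_state_space Ix Iy) Iz.
have -> : - (2 * t) * (phi z * pi z) + (t ^+ 2 * pi z + phi z ^+ 2 * pi z) =
  (phi z - t) ^+ 2 * pi z by ring.
by rewrite mulr_ge0 ?sqr_ge0// ltW// pi_gt0.
Qed.

(* The mass beyond d is controlled by G d, since [G d = k \int (x - m) pi] over the
   tail; hence no growth condition on phi is needed at the ends. *)
Lemma eigenfunction_flux_sqr_le d e : I d ->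
  (forall x y, I x -> I y -> x <= y -> (m <= d -> d <= x) -> (d < m -> y <= d) ->
     \int[leb]_(z in `[x, y]) (phi z ^+ 2 * pi z) <= e) ->
  k * `|d - m| * F d ^+ 2 <= lam ^+ 2 * e * G d.
Proof.
move=> Id tail.
have e0 : 0 <= e.
  apply: le_trans (tail d d Id Id (lexx _) _ _) => //.
  by rewrite set_itv1 Rintegral_set1.
have [_ _ _ _ [Fl Fu]] := phi_eigen.
(* The point y lies beyond d on the side away from m; it is later moved towards the end, where F
   vanishes. *)
have step y : I y -> (m <= d -> d <= y) -> (d < m -> y <= d) ->
    k * `|d - m| * (F d - F y) ^+ 2 <= lam ^+ 2 * e * G d.
  move=> Iy dy yd.
  pose a := Num.min d y; pose b := Num.max d y.
  have ab : a <= b by rewrite /a /b ge_min le_max lexx.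
  have Ia : I a by exact: state_space_min.
  have Ib : I b by exact: state_space_max.
  have inc := eigenfunction_flux_increment Ia Ib ab.
  have Fab : (F d - F y) ^+ 2 = (F b - F a) ^+ 2.
    by rewrite /a /b; case: (leP d y) => _ //; rewrite -sqrrN opprB.
  have taile : \int[leb]_(z in `[a, b]) (phi z ^+ 2 * pi z) <= e.
    apply: tail => //.
    + by move=> md; rewrite /a le_min lexx dy.
    + by move=> dm; rewrite /b ge_max lexx yd.
  have P0 : 0 <= \int[leb]_(z in `[a, b]) pi z.
    by apply: Rintegral_ge0 => z /(itvcc_state_space Ia Ib) Iz; rewrite ltW// pi_gt0.
  have GP : k * `|d - m| * \int[leb]_(z in `[a, b]) pi z <= G d.
    apply: (@le_trans _ _ (G d - G y)); last by rewrite gerBl ltW// G_gt0.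
    have i0 := continuous_integrable_itvcc Ia Ib pi_continuous.
    have cz z : I z -> {for z, continuous (fun z => - (k * (z - m) * pi z))}.
      move=> Iz; apply: continuousN; apply: continuousM; last exact: pi_continuous.
      apply: continuousM; first exact: cst_continuous.
      by apply: continuousB; [exact: cvg_id|exact: cst_continuous].
    have i1 := continuous_integrable_itvcc Ia Ib cz.
    have := Rintegral_derive Ia Ib ab dG cz.
    rewrite -RintegralZl//.
    have i2 : leb.-integrable `[a, b] (EFin \o (fun z => k * `|d - m| * pi z)).
      by apply: integrable_scale.
    have [md|dm] := leP m d.
      rewrite (_ : G d - G y = G a - G b); last by rewrite /a /b min_l ?max_r ?dy.
      move=> int; rewrite -[leRHS]opprB -int -[leRHS]mulN1r -RintegralZl//.
      apply: le_Rintegral => //; first exact: integrable_scale.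
      move=> z zab; have Iz := itvcc_state_space Ia Ib zab.
      rewrite mulN1r opprK ler_wpM2r ?(ltW (pi_gt0 Iz))// ler_wpM2l ?(ltW k_gt0)//.
      rewrite ger0_norm ?subr_ge0// lerD2r.
      by move: zab; rewrite /= in_itv/= /a min_l ?dy// => /andP[].
    rewrite (_ : G d - G y = G b - G a); last by rewrite /a /b min_r ?max_l ?yd.
    move=> <-; apply: le_Rintegral => // z zab.
    have Iz := itvcc_state_space Ia Ib zab.
    rewrite -mulNr ler_wpM2r ?(ltW (pi_gt0 Iz))// -mulrN ler_wpM2l ?(ltW k_gt0)//.
    rewrite ltr0_norm ?subr_lt0// lerN2 lerD2r.
    by move: zab; rewrite /= in_itv/= /b max_l ?yd// => /andP[].
  apply: le_trans (ler_wpM2l _ (_ : _ <= lam ^+ 2 * e * \int[leb]_(z in `[a, b]) pi z)) _.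
  - by rewrite mulr_ge0 ?(ltW k_gt0).
  - rewrite Fab (le_trans inc)// ler_wpM2r// ler_wpM2l ?sqr_ge0//.
  rewrite mulrCA ler_wpM2l// mulr_ge0 ?sqr_ge0//.
have X0 : 0 <= k * `|d - m| by rewrite mulr_ge0 ?(ltW k_gt0).
set X := k * _ in X0 step *.
apply/ler_addgt0Pr => f f0.
(* Makes the cross term 2 X (F d)(F y) at most f; the added 1 keeps the denominator positive when F
   d = 0. *)
pose g := f / (2 * X * `|F d| + 1).
have XF : 0 <= 2 * X * `|F d| by rewrite mulr_ge0// mulr_ge0.
have D0 : 0 < 2 * X * `|F d| + 1 by rewrite ltr_pwDr.
have g0 : 0 < g by rewrite divr_gt0.
have [y [Iy dy yd Fy]] : exists y, [/\ I y, m <= d -> d <= y, d < m -> y <= d & `|F y| <= g].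
  have [md|dm] := leP m d.
    have [d' Id' H] := (upper_end_cvg0P F Id).1 Fu g g0.
    exists (Num.max d d'); split => //.
    + exact: state_space_max.
    + by rewrite le_max lexx.
    + by apply: H; [exact: state_space_max|rewrite le_max lexx orbT].
  have [d' Id' H] := (lower_end_cvg0P F Id).1 Fl g g0.
  exists (Num.min d d'); split => //.
  + exact: state_space_min.
  + by rewrite ge_min lexx.
  + by apply: H; [exact: state_space_min|rewrite ge_min lexx orbT].
have := step y Iy dy yd.
have FF : F d * F y <= `|F d| * g.
  by rewrite (le_trans (ler_norm _))// normrM ler_wpM2l.
have gf : 2 * X * (`|F d| * g) <= f.
  rewrite mulrA /g mulrCA ger_pMr// ler_pdivrMr// mul1r lerDl ler01//.
have := ler_wpM2l (mulr_ge0 (ler0n _ 2) X0) FF.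
have := sqr_ge0 (F y).
move=> h1 h2 h3.
have h4 : X * F d ^+ 2 = X * (F d - F y) ^+ 2 + 2 * X * (F d * F y) - X * F y ^+ 2 by ring.
have h5 : 0 <= X * F y ^+ 2 by rewrite mulr_ge0.
rewrite h4; lra.
Qed.

Lemma first_eigenvalue_ge : k <= lam.
Proof.
rewrite leNgt; apply/negP => lamk.
(* J is nonincreasing and vanishes at both ends, hence identically. *)
pose J x := - (k * (x - m) * (F x ^+ 2 / G x)) + k * (F x * phi x).
(* In J' the terms k F^2 / G cancel; what is left is completed to a square, with remainder lam (k -
   lam) pi phi^2. *)
pose j x := - (pi x * (k * (x - m) * F x / G x - lam * phi x) ^+ 2) -
  lam * (k - lam) * (pi x * phi x ^+ 2).
have dJ x : I x -> is_derive x (1 : R) J (j x).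
  move=> Ix; have gn := lt0r_neq0 (G_gt0 Ix).
  have dJ := is_derive_lyapunov k m (eigenfunction_flux_derive Ix) (dG Ix)
    (eigenfunction_derive Ix) gn.
  apply: (is_derive_eq dJ); rewrite /j.
  by set g := 2^-1 * sigma x ^+ 2 * pi x in gn *; field.
have j_le0 x : I x -> j x <= - (lam * (k - lam) * (pi x * phi x ^+ 2)).
  move=> Ix; rewrite /j gerDr oppr_le0 mulr_ge0 ?sqr_ge0//.
  by rewrite ltW// pi_gt0.
have jn x : I x -> j x <= 0.
  move=> Ix; apply: le_trans (j_le0 x Ix) _.
  rewrite oppr_le0 mulr_ge0//; first by rewrite mulr_ge0 ?subr_ge0 ?ltW.
  by rewrite mulr_ge0 ?sqr_ge0// ltW// pi_gt0.
have J_down x y : I x -> I y -> x <= y -> J y <= J x.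
  move=> Ix Iy xy; apply: (is_derive_le0_ge xy (f := j)) => z /andP[xz zy].
  have Iz : I z by apply: (state_space_itv Ix Iy); rewrite xz.
  by split; [exact: dJ|exact: jn].
have J0 x : I x -> J x = 0.
  move=> Ix; apply/eqP; rewrite -normr_le0; apply/ler_addgt0Pr => e e0; rewrite add0r.
  (* These bounds make each of the two terms of J at most e / 2: the first through
     [eigenfunction_flux_sqr_le], the second through [SL_graph_boundary]. *)
  have e1 : 0 < e / (2 * (lam ^+ 2)) by rewrite divr_gt0// mulr_gt0// exprn_gt0.
  have e2 : 0 < e / (2 * k) by rewrite divr_gt0// mulr_gt0.
  have [Lphi _ _ _ _] := phi_eigen.
  have [c0 [d0 [Ic0 Id0 cd0 tail]]] := integral_tail x12 e1 Lphi.2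
    (fun x Ix => mulr_ge0 (sqr_ge0 (phi x)) (ltW (pi_gt0 Ix))).
  (* Staying below [m'] keeps c strictly below m, so that the lower tail is the one considered at
     c. *)
  have [m' Im' m'm] := state_space_lt_ex Im.
  pose c1 := Num.min x (Num.min m' c0); pose d1 := Num.max x (Num.max m d0).
  have Ic1 : I c1 by do 2 apply: state_space_min => //.
  have Id1 : I d1 by do 2 apply: state_space_max => //.
  have [c [d [Ic Id cc1 d1d [Bc [Bd _]]]]] := SL_graph_boundary x12 pi_gt0
    pi_continuous pi_mass eigenfunction_SL_graph eigenfunction_SL_graph Ic1 Id1 e2.
  have [cx cm' cc0] : [/\ c <= x, c <= m' & c <= c0].
    by move: cc1; rewrite !le_min => /and3P.
  have [xd md d0d] : [/\ x <= d, m <= d & d0 <= d].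
    by move: d1d; rewrite !ge_max => /and3P.
  have small z : I z -> `|F z| * `|phi z| <= e / (2 * k) ->
     (forall x y, I x -> I y -> x <= y -> (m <= z -> z <= x) -> (z < m -> y <= z) ->
     \int[leb]_(z in `[x, y]) (phi z ^+ 2 * pi z) <= e / (2 * (lam ^+ 2))) ->
     `|J z| <= e.
    move=> Iz Bz tz; have := eigenfunction_flux_sqr_le Iz tz.
    have Gz := G_gt0 Iz; rewrite -ler_pdivrMr// -mulrA => Kz.
    have lam2 : lam ^+ 2 * (e / (2 * lam ^+ 2)) = e / 2.
      by field; rewrite gt_eqF.
    rewrite lam2 in Kz.
    apply: le_trans (ler_normD _ _) _; rewrite normrN normrM [in X in X + _]normrM.
    have FG0 : 0 <= F z ^+ 2 / G z by rewrite divr_ge0 ?sqr_ge0// ltW.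
    rewrite (ger0_norm FG0) (gtr0_norm k_gt0) normrM (gtr0_norm k_gt0) normrM.
    have := ler_wpM2l (ltW k_gt0) Bz.
    have -> : k * (e / (2 * k)) = e / 2 by field; rewrite gt_eqF.
    move: Kz; lra.
  have Jc : `|J c| <= e.
    apply: small => // y z Iy Iz yz _ zc; apply: tail => //; left.
    by rewrite (le_trans _ cc0)// zc// (le_lt_trans cm').
  have Jd : `|J d| <= e.
    apply: small => // y z Iy Iz yz dy _; apply: tail => //; right.
    by rewrite (le_trans d0d)// dy.
  have Jcx := J_down c x Ic Ix cx; have Jxd := J_down x d Ix Id xd.
  move: Jc Jd; rewrite !ler_norml => /andP[? ?] /andP[? ?].
  by apply/andP; split; lra.
have [_ [x0 Ix0 phix0] _ _ _] := phi_eigen.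
have : j x0 = 0.
  have nJ : \forall y \near x0, (fun=> 0) y = J y.
    by have := state_space_nbhs Ix0; apply: filterS => y Iy; rewrite J0.
  have := near_eq_is_derive nJ (is_derive_cst 0 x0 1).
  by move/is_derive_derive1E; rewrite (is_derive_derive1E (dJ _ Ix0)).
have := j_le0 _ Ix0 => /[swap] ->; rewrite leNgt => /negP; apply.
rewrite oppr_lt0 mulr_gt0//; first by rewrite mulr_gt0 ?subr_gt0.
by rewrite mulr_gt0 ?pi_gt0// exprn_even_gt0.
Qed.

End first_eigenvalue.

(** * The variational bound *)

Section cutoff.
Context {R : realType}.
Notation leb := (@lebesgue_measure R).
Variable e : R.
Hypothesis e0 : 0 < e.

(** A ramp between e and 2 e instead of a jump: the test source must be continuous for
    [convergence_rate_gap] to apply. *)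
Definition cutoff (t : R) : R := Num.min 1 (Num.max 0 (t / e - 1)).

Lemma cutoff_ge0 t : 0 <= cutoff t.
Proof. by rewrite le_min ler01 le_max lexx. Qed.

Lemma cutoff_le1 t : cutoff t <= 1.
Proof. by rewrite ge_min lexx. Qed.

Lemma cutoff_eq0 t : t <= e -> cutoff t = 0.
Proof.
move=> te; rewrite /cutoff max_l; first by rewrite min_r.
by rewrite subr_le0 ler_pdivrMr// mul1r.
Qed.

Lemma cutoff_eq1 t : 2 * e <= t -> cutoff t = 1.
Proof.
move=> et; rewrite /cutoff min_l// le_max; apply/orP; right.
by rewrite lerBrDr ler_pdivlMr//; lra.
Qed.

Lemma cutoff_continuous (t : R) : {for t, continuous cutoff}.
Proof.
apply: (@continuous_min R R (fun=> 1) (fun t => Num.max 0 (t / e - 1))).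
  exact: cst_continuous.
apply: (@continuous_max R R (fun=> 0) (fun t => t / e - 1)).
  exact: cst_continuous.
apply: continuousB; last exact: cst_continuous.
by apply: continuousM; [exact: cvg_id|exact: cst_continuous].
Qed.

(** For t < 0 the interval is empty, and 0 is the right value because [cutoff] vanishes up to e. *)
Definition cutoff_primitive (t : R) : R := \int[leb]_(s in `[0, t]) cutoff s.

Lemma cutoff_primitive_eq0 (t : R) : t <= e -> cutoff_primitive t = 0.
Proof.
move=> te; rewrite /cutoff_primitive (@eq_Rintegral _ _ _ leb _ (fun=> 0)).
  by rewrite /Rintegral integral0.
move=> s; rewrite inE/= in_itv/= => /andP[_ st].
by rewrite cutoff_eq0// (le_trans st).
Qed.

Lemma cutoff_primitive_derive (t : R) : 0 < t ->
  is_derive t (1 : R) cutoff_primitive (cutoff t).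
Proof.
move=> t0; apply: (@is_derive_Rintegral _ -oo%E +oo%E cutoff t 0) => //.
- by split; rewrite ?ltNyr ?ltry.
- by split; rewrite ?ltNyr ?ltry.
- by move=> y _; exact: cutoff_continuous.
- by move=> y _ y0; rewrite (cutoff_primitive_eq0 (ltW e0)) add0r.
Qed.

End cutoff.

Section variational_bound.
Context {R : realType} (x1 x2 : \bar R) (pi sigma : R -> R).
Notation leb := (@lebesgue_measure R).
Notation I := (state_space x1 x2).
Notation L2 := (square_integrable x1 x2 pi).
Notation S := (fun x => 2^-1 * sigma x ^+ 2 * pi x).

Hypothesis x12 : (x1 < x2)%E.
Hypothesis pi_gt0 : forall x, I x -> 0 < pi x.
Hypothesis pi_continuous : forall x, I x -> {for x, continuous pi}.
Hypothesis pi_mass : (\int[leb]_(x in I) (pi x)%:E = 1)%E.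
Hypothesis sigma_neq0 : forall x, I x -> sigma x != 0.
Hypothesis variance_continuous : forall x, I x ->
  {for x, continuous (variance_function sigma)}.
Hypothesis average_finite : leb.-integrable I
  (fun x => (variance_function sigma x * pi x)%:E).

(* G is the flux of x - m for some other diffusion with the same stationary density. *)
Variables (k m : R) (G : R -> R).
Hypothesis k_gt0 : 0 < k.
Hypothesis G_gt0 : forall x, I x -> 0 < G x.
Hypothesis dG : forall x, I x -> is_derive x (1 : R) G (- (k * (x - m) * pi x)).
Hypothesis Gl : G x @[x --> lower_end x1] --> 0.
Hypothesis Gu : G x @[x --> upper_end x2] --> 0.
Let l x := x - m.
Hypothesis Ll : L2 l.

Let S_gt0 x : I x -> 0 < S x. Proof. exact: variance_density_gt0. Qed.

Let S_continuous x : I x -> {for x, continuous S}.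
Proof.
by move=> Ix; apply: continuousM; [exact: variance_continuous|exact: pi_continuous].
Qed.

Let G_continuous x : I x -> {for x, continuous G}.
Proof. by move=> Ix; exact: is_derive_continuous (dG Ix). Qed.

Let l_continuous x : {for x, continuous l}.
Proof. by apply: continuousB; [exact: cvg_id|exact: cst_continuous]. Qed.

Let l_derive x : is_derive x (1 : R) l 1.
Proof. by rewrite -[X in is_derive _ _ _ X]subr0; apply: is_deriveB. Qed.

Section test_function.
Variable e : R.
Hypothesis e0 : 0 < e.

(** Cutting x - m off along the level sets of G makes its flux explicit: as G' = -k (x - m) pi, the
    chain rule turns -h pi into the derivative of a function of G. That h has mean zero against pi,
    the solvability condition for Lu = h, comes for free. *)
Definition test_source x := cutoff e (G x) * (x - m).
Definition test_flux x := k^-1 * cutoff_primitive e (G x).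

Let h := test_source.
Let F := test_flux.

Lemma test_flux_derive x : I x -> is_derive x (1 : R) F (- (h x * pi x)).
Proof.
move=> Ix; have dT := cutoff_primitive_derive e0 (G_gt0 Ix).
have dF : is_derive x (1 : R) F
    (k^-1 * (cutoff e (G x) * - (k * (x - m) * pi x))).
  exact: (is_deriveZ k^-1 (is_derive1_comp dT (dG Ix))).
apply: (is_derive_eq dF); rewrite /h /test_source; field.
by rewrite gt_eqF.
Qed.

Let h_continuous x : I x -> {for x, continuous h}.
Proof.
move=> Ix; apply: continuousM; last exact: l_continuous.
apply: (@continuous_comp _ _ _ G (cutoff e)); first exact: G_continuous.
exact: cutoff_continuous.
Qed.

Let F_continuous x : I x -> {for x, continuous F}.
Proof. by move=> Ix; exact: is_derive_continuous (test_flux_derive Ix). Qed.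

Let w x := F x / S x.

Let w_continuous x : I x -> {for x, continuous w}.
Proof.
move=> Ix; apply: continuousM; first exact: F_continuous.
by apply: continuousV; [rewrite gt_eqF// S_gt0|exact: S_continuous].
Qed.

(** G tends to 0 at both ends, so the set where G > e lies in a compact interval. *)
Lemma test_support : exists c d, [/\ I c, I d, c < d &
  forall y, I y -> y <= c \/ d <= y -> h y = 0 /\ F y = 0].
Proof.
have [x0 Ix0] := state_space_nonempty x12.
have [c1 Ic1 Hc] := (lower_end_cvg0P G Ix0).1 Gl e e0.
have [d1 Id1 Hd] := (upper_end_cvg0P G Ix0).1 Gu e e0.
have [d Id c1d] := state_space_gt_ex (state_space_max Ic1 Id1).
exists c1, d; split => //; first by rewrite (le_lt_trans _ c1d)// le_max lexx.
move=> y Iy cd; have Ge : G y <= e.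
  apply: le_trans (ler_norm _) _; case: cd => [|dy]; first exact: Hc.
  by apply: Hd => //; rewrite (le_trans _ dy)// (le_trans _ (ltW c1d))// le_max lexx orbT.
by rewrite /h /F /test_source /test_flux cutoff_eq0// cutoff_primitive_eq0// mulr0 mul0r.
Qed.

Lemma test_source_square_integrable : L2 test_source.
Proof.
rewrite -/h; have mh : measurable_fun I h by exact: continuous_measurable_state_space.
have mI := @state_space_measurable _ x1 x2.
split => //; apply: (@le_integrable _ _ _ leb I mI _
    (fun x => (l x ^+ 2 * pi x)%:E)); last by case: Ll.
  apply/measurable_EFinP; apply: measurable_funM.
    exact: measurable_funM.
  exact: density_measurable.
move=> x Ix; rewrite /= lee_fin (normrM (h x ^+ 2)) (normrM (l x ^+ 2)) ler_wpM2r//.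
rewrite /h /test_source exprMn (normrM (cutoff e (G x) ^+ 2)) ler_piMl//.
by rewrite ger0_norm ?sqr_ge0// exprn_ile1 ?cutoff_ge0 ?cutoff_le1.
Qed.

Let h_L2 : L2 h := test_source_square_integrable.

(** u is a primitive of F / S. It is constant on either side of the support, hence bounded, hence in
    L^2(pi) by finiteness of the mass, whatever the behaviour of sigma at the ends. *)
Lemma test_function : exists u, [/\ SL_graph x1 x2 pi sigma u h &
  forall x, I x -> is_derive x (1 : R) u (w x)].
Proof.
have [c [d [Ic Id cd supp]]] := test_support.
have w0 y : I y -> y <= c \/ d <= y -> w y = 0.
  by move=> Iy /(supp y Iy)[_ Fy]; rewrite /w Fy mul0r.
(* For x <= c' the integral gives 0, which agrees with the primitive because w vanishes up to c;
   starting strictly before c also gives differentiability at c. *)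
have [c' Ic' c'c] := state_space_lt_ex Ic.
pose u x := \int[leb]_(z in `[c', x]) w z.
have u0 y : I y -> y <= c -> u y = 0.
  move=> Iy yc; rewrite /u (@eq_Rintegral _ _ _ leb _ (fun=> 0)).
    by rewrite /Rintegral integral0.
  move=> z; rewrite inE/= in_itv/= => /andP[c'z zy].
  have Iz : I z by apply: (state_space_itv Ic' Iy); rewrite c'z.
  by apply: w0 => //; left; exact: le_trans yc.
have du x : I x -> is_derive x (1 : R) u (w x).
  move=> Ix; have [c'x|xc'] := ltP c' x.
    apply: (@is_derive_Rintegral _ x1 x2 w x c') => // y Iy _.
    by rewrite (u0 c' Ic' (ltW c'c)) add0r.
  have xc : x < c by exact: le_lt_trans c'c.
  rewrite w0//; last by left; exact: ltW.
  have : \forall y \near x, (fun=> 0) y = u y.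
    have := lt_nbhsl xc; have := state_space_nbhs Ix.
    by apply: filterS2 => y Iy yc; rewrite u0// ltW.
  by move/near_eq_is_derive; apply; exact: is_derive_cst.
have cu x : I x -> {for x, continuous u}.
  by move=> Ix; exact: is_derive_continuous (du x Ix).
have [M HM] : exists M, forall x, I x -> `|u x| <= M.
  have [|z _ Hz] := @EVT_max R (fun x => `|u x|) c d (ltW cd).
    apply: (continuous_within_itvcc Ic Id) => x Ix.
    by apply: continuous_comp; [exact: cu|exact: norm_continuous].
  exists `|u z| => x Ix.
  have ud y : I y -> d <= y -> u y = u d.
    move=> Iy dy; have ud := Rintegral_derive Id Iy dy du w_continuous.
    apply/eqP; rewrite -subr_eq0 -ud (@eq_Rintegral _ _ _ leb _ (fun=> 0)).
      by rewrite /Rintegral integral0.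
    move=> t; rewrite inE => /[dup] /(itvcc_state_space Id Iy) It.
    by rewrite /= in_itv/= => /andP[dt _]; apply: w0 => //; right.
  have [xc|cx] := leP x c; first by rewrite u0// normr0.
  have [dx|xd] := leP d x.
    by rewrite ud// Hz// in_itv/= lexx ltW.
  by rewrite Hz// in_itv/= !ltW.
have Lu : L2 u.
  have mu : measurable_fun I u by exact: continuous_measurable_state_space.
  have mI := @state_space_measurable _ x1 x2.
  split => //; have [_ iM] := square_integrable_cst pi_gt0 pi_continuous pi_mass M.
  apply: (@le_integrable _ _ _ leb I mI _ _ _ _ iM).
    apply/measurable_EFinP; apply: measurable_funM; first exact: measurable_funM.
    exact: density_measurable.
  move=> x Ix; rewrite /= lee_fin (normrM (u x ^+ 2)) (normrM (M ^+ 2)).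
  rewrite ler_wpM2r// !normrX lerXn2r ?nnegrE//.
  by rewrite (le_trans (HM x Ix))// ler_norm.
exists u; split => //.
have fluxE x : I x -> flux pi sigma u x = F x.
  move=> Ix; rewrite /flux (is_derive_derive1E (du x Ix)) /w mulrCA divff ?mulr1//.
  by rewrite gt_eqF// S_gt0.
split => //.
- by move=> x /du[].
- move=> x y Ix Iy xy; rewrite !fluxE//.
  have chp z : I z -> {for z, continuous (fun z => h z * pi z)}.
    by move=> Iz; apply: continuousM; [exact: h_continuous|exact: pi_continuous].
  rewrite -(Rintegral_derive Ix Iy (ltW xy) test_flux_derive).
    rewrite -[RHS]mulN1r -RintegralZl//.
      by apply: eq_Rintegral => z _; rewrite mulN1r.
    exact: (continuous_integrable_itvcc Ix Iy chp).
  by move=> z Iz; apply: continuousN; exact: chp.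
- split.
  + apply/(lower_end_cvg0P _ Ic) => f f0; exists c => // y Iy yc.
    by rewrite fluxE// (supp y Iy _).2 ?normr0 ?(ltW f0)//; left.
  + apply/(upper_end_cvg0P _ Ic) => f f0; exists d => // y Iy dy.
    by rewrite fluxE// (supp y Iy _).2 ?normr0 ?(ltW f0)//; right.
Qed.

Lemma supported_Rintegral f c d : I c -> I d ->
  (forall y, I y -> y <= c \/ d <= y -> f y = 0) ->
  \int[leb]_(x in I) f x = \int[leb]_(x in `[c, d]) f x.
Proof.
move=> Ic Id f0; rewrite Rintegral_mkcond [RHS]Rintegral_mkcond.
apply: eq_Rintegral => x _; rewrite !patchE.
case: ifPn => [|xI]; last first.
  rewrite ifF//; apply/negbTE; apply: contra xI; rewrite !inE.
  exact: itvcc_state_space.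
rewrite inE => Ix; case: ifPn => //; rewrite notin_setE/= in_itv/= => /negP.
rewrite negb_and -!ltNge => /orP[xc|dx]; apply: f0 => //.
  by left; exact: ltW.
by right; exact: ltW.
Qed.

(** Put B = <h, x - m> and E = <h, u>. By parts, B is the integral of F and E that of F^2 / S, so
    B^2 <= E A. The gap gives lam E <= <h, h>, and <h, h> <= B because the cutoff lies in [0, 1].
    Hence lam B^2 <= A B. *)
Lemma test_energy_le lam : convergence_rate x1 x2 pi sigma lam ->
  lam * L2_product x1 x2 pi h l <= average_variance x1 x2 pi sigma.
Proof.
move=> rate; have lam_gt0 : 0 < lam by case: rate.
have [u [graph du]] := test_function.
have [c [d [Ic Id cd supp]]] := test_support.
pose A := average_variance x1 x2 pi sigma; rewrite -/A.
have cu x : I x -> {for x, continuous u}.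
  by move=> Ix; exact: is_derive_continuous (du x Ix).
have gap := convergence_rate_gap x12 pi_gt0 pi_continuous pi_mass rate
  (conj graph h_continuous).
pose B := L2_product x1 x2 pi h l.
have [Fc Fd] : F c = 0 /\ F d = 0.
  by rewrite (supp c Ic _).2 ?(supp d Id _).2; [|right|left].
have hB : L2_product x1 x2 pi h h <= B.
  apply: le_Rintegral.
  - exact: state_space_measurable.
  - exact: square_integrable_mul.
  - exact: square_integrable_mul.
  move=> x Ix; rewrite ler_wpM2r ?(ltW (pi_gt0 Ix))// /h /test_source -/(l x).
  have -> : cutoff e (G x) * l x * (cutoff e (G x) * l x) =
    cutoff e (G x) * (cutoff e (G x) * l x ^+ 2) by ring.
  rewrite -mulrA -expr2 ler_piMl ?cutoff_le1// mulr_ge0 ?sqr_ge0//.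
  exact: cutoff_ge0.
have cF2S x : I x -> {for x, continuous (fun x => F x * w x)}.
  by move=> Ix; apply: continuousM; [exact: F_continuous|exact: w_continuous].
have ch f : (forall x, I x -> {for x, continuous f}) ->
    forall x, I x -> {for x, continuous (fun x => h x * f x * pi x)}.
  move=> cf x Ix; apply: continuousM; last exact: pi_continuous.
  by apply: continuousM; [exact: h_continuous|exact: cf].
have byparts v v' : (forall x, I x -> is_derive x (1 : R) v (v' x)) ->
    (forall x, I x -> {for x, continuous v'}) ->
    L2_product x1 x2 pi h v = \int[leb]_(x in `[c, d]) (F x * v' x).
  move=> dv cv'.
  have cv x : I x -> {for x, continuous v}.
    by move=> Ix; exact: is_derive_continuous (dv x Ix).
  have cFv x : I x -> {for x, continuous (fun x => F x * v' x)}.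
    by move=> Ix; apply: continuousM; [exact: F_continuous|exact: cv'].
  rewrite /L2_product (@supported_Rintegral _ c d)//; last first.
    by move=> y Iy /(supp y Iy)[-> _]; rewrite !mul0r.
  have dFv x : I x -> is_derive x (1 : R) (fun x => F x * v x)
      ((-1) * (h x * v x * pi x) + F x * v' x).
    move=> Ix; apply: (is_derive_eq (is_deriveM (test_flux_derive Ix) (dv x Ix))).
    by rewrite /GRing.scale/=; ring.
  have := Rintegral_derive Ic Id (ltW cd) dFv.
  have i1 := continuous_integrable_itvcc Ic Id (ch v cv).
  have i2 := continuous_integrable_itvcc Ic Id cFv.
  rewrite Rintegral_comb// Fc Fd !mul0r subrr => H.
  apply/eqP; rewrite eq_sym -subr_eq0 addrC -mulN1r; apply/eqP; apply: H.
  move=> x Ix; apply: continuousD; last exact: cFv.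
  by apply: continuousM; [exact: cst_continuous|exact: ch].
have hu : L2_product x1 x2 pi h u = \int[leb]_(x in `[c, d]) (F x * w x) by exact: byparts.
have BE : B = \int[leb]_(x in `[c, d]) F x.
  have cst1 x : I x -> {for x, continuous (fun=> 1 : R)} by move=> _; exact: cst_continuous.
  rewrite /B (byparts l (fun=> 1) (fun x _ => l_derive x) cst1).
  by apply: eq_Rintegral => x _; rewrite mulr1.
have iS := continuous_integrable_itvcc Ic Id S_continuous.
have iF := continuous_integrable_itvcc Ic Id F_continuous.
have iFw := continuous_integrable_itvcc Ic Id cF2S.
have SA : \int[leb]_(x in `[c, d]) S x <= A.
  by apply: Rintegral_itvcc_le => // x Ix; rewrite ltW// S_gt0.
have cs : B ^+ 2 <= L2_product x1 x2 pi h u * A.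
  apply: (@le_trans _ _ (L2_product x1 x2 pi h u * \int[leb]_(x in `[c, d]) S x)).
    apply: quadratic_ge0_discriminant.
      by apply: Rintegral_ge0 => x /(itvcc_state_space Ic Id) Ix; rewrite ltW// S_gt0.
    move=> t; rewrite hu BE.
    have -> : \int[leb]_(x in `[c, d]) (F x * w x) -
        2 * t * \int[leb]_(x in `[c, d]) F x + t ^+ 2 * \int[leb]_(x in `[c, d]) S x =
        \int[leb]_(x in `[c, d]) ((- (2 * t)) * F x + (t ^+ 2 * S x + F x * w x)).
      rewrite !Rintegral_comb//; last by apply: integrable_comb.
      ring.
    apply: Rintegral_ge0 => x /(itvcc_state_space Ic Id) Ix.
    have -> : - (2 * t) * F x + (t ^+ 2 * S x + F x * w x) = S x * (w x - t) ^+ 2.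
      rewrite /w; set s := S x; have sn : s != 0 by rewrite gt_eqF// S_gt0.
      by field.
    by rewrite mulr_ge0 ?sqr_ge0// ltW// S_gt0.
  rewrite ler_wpM2l// hu; apply: Rintegral_ge0 => x /(itvcc_state_space Ic Id) Ix.
  by rewrite /w mulrA -expr2 divr_ge0 ?sqr_ge0// ltW// S_gt0.
have A0 : 0 <= A.
  apply: Rintegral_ge0 => x Ix; exact: ltW (S_gt0 Ix).
have B0 : 0 <= B by apply: le_trans hB; exact: L2_product_ge0.
move: B0; rewrite le_eqVlt => /predU1P[B0|B0].
  by rewrite -/B -B0 mulr0.
rewrite -/B -(ler_pM2l B0).
have -> : B * (lam * B) = lam * B ^+ 2 by ring.
apply: le_trans (ler_wpM2l (ltW lam_gt0) cs) _.
rewrite mulrA ler_wpM2r// (le_trans gap)//.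
Qed.

End test_function.

Theorem convergence_rate_le lam : convergence_rate x1 x2 pi sigma lam ->
  lam * L2_product x1 x2 pi l l <= average_variance x1 x2 pi sigma.
Proof.
move=> rate; have lam_gt0 : 0 < lam by case: rate.
pose V := L2_product x1 x2 pi l l; rewrite -/V.
have ll0 x : I x -> 0 <= l x * l x * pi x.
  by move=> Ix; rewrite mulr_ge0 -?expr2 ?sqr_ge0// ltW// pi_gt0.
have ill : leb.-integrable I (EFin \o (fun x => l x * l x * pi x)).
  exact: square_integrable_mul.
apply/ler_addgt0Pr => f f0; have f1 : 0 < f / lam by rewrite divr_gt0.
have [c [d [Ic Id cd ex]]] := integral_exhaustion x12 f1 ill ll0.
have := ex c d Ic Id (lexx _) (lexx _) => Vle.
have [z zcd Gz] : exists2 z, z \in `[c, d] & forall t, t \in `[c, d] -> G z <= G t.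
  have [|z zcd Hz] := @EVT_min R G c d cd.
    by apply: (continuous_within_itvcc Ic Id).
  by exists z.
have Iz : I z by apply: (itvcc_state_space Ic Id).
(* With 2 e the minimum of G on [c, d], the cutoff is 1 there and the test source coincides with x -
   m. *)
pose e := G z / 2; have e0 : 0 < e by rewrite divr_gt0 ?G_gt0.
have := test_energy_le e0 rate; set B := L2_product _ _ _ _ _ => BA.
have ihl : leb.-integrable I (EFin \o (fun x => test_source e x * l x * pi x)).
  apply: square_integrable_mul => //; exact: test_source_square_integrable.
have hl0 x : I x -> 0 <= test_source e x * l x * pi x.
  move=> Ix; rewrite /test_source -/(l x) -mulrA -mulrA mulr_ge0 ?cutoff_ge0// mulrA.
  exact: ll0.
have VB : V - f / lam <= B.
  apply: le_trans Vle _.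
  apply: le_trans (Rintegral_itvcc_le Ic Id ihl hl0).
  rewrite le_eqVlt; apply/predU1P; left; apply: eq_Rintegral => t.
  rewrite inE/= => tcd; rewrite /test_source -/(l t) cutoff_eq1 ?mul1r//.
  by rewrite /e mulrC divfK ?Gz.
have := ler_wpM2l (ltW lam_gt0) VB.
have -> : lam * (V - f / lam) = lam * V - f by field; rewrite gt_eqF.
lra.
Qed.

End variational_bound.

Theorem mainTheorem5 (R : realType) (x1 x2 : \bar R) (pi mu sigma : R -> R)
    (hpearson : pearson_diffusion x1 x2 pi mu sigma)
    (hrate : exists lam1 : R, convergence_rate x1 x2 pi sigma lam1) :
  optimal x1 x2 pi sigma.
Proof.
have [rd [p [q [p_size _ mu_p var_q q_end]]]] := hpearson.
have [lam1 rate1] := hrate; exists lam1 => // mu' sigma' lam1' rd' avg rate'.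
have [k [m [k0 Im dG graph Ale]]] :=
  pearson_linear_eigenfunction rd p_size mu_p var_q q_end.
have [x12 pi_gt0 pi_cont pi_mass sigma_neq0 _ avg_fin _ _] := rd.
have [_ _ _ _ sigma'_neq0 var'_cont avg'_fin _ _] := rd'.
have klam1 : k <= lam1.
  have [lam1_gt0 [phi phi_eigen] _] := rate1.
  exact: (first_eigenvalue_ge x12 pi_gt0 pi_cont pi_mass sigma_neq0 k0 Im dG
    lam1_gt0 phi_eigen).
apply: le_trans klam1.
pose G x := 2^-1 * sigma x ^+ 2 * pi x.
have G_gt0 x : state_space x1 x2 x -> 0 < G x by exact: variance_density_gt0.
have [Ll _ _ _ [Gl Gu]] := graph.
have fluxE : flux pi sigma (fun x => x - m) = G.
  apply/funext => x; rewrite /flux.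
  have dl : is_derive x (1 : R) (fun x => x - m) 1.
    by rewrite -[X in is_derive _ _ _ X]subr0; apply: is_deriveB.
  by rewrite (is_derive_derive1E dl) mulr1.
rewrite fluxE in Gl Gu.
have bound := convergence_rate_le x12 pi_gt0 pi_cont pi_mass sigma'_neq0 var'_cont
  avg'_fin k0 G_gt0 dG Gl Gu Ll rate'.
(* With V the variance of pi about m and A the common average variance, lam1' V <= A <= k V.
   Dividing by V requires V > 0, which follows from A <= k V once A > 0; the integral of G over
   [m, d] bounds A from below. *)
rewrite avg in bound; have := le_trans bound Ale.
rewrite ler_pM2r// -(ltr_pM2l k0) mulr0; apply: lt_le_trans Ale.
have [d Id md] := state_space_gt_ex Im.
have [|z zmd Gz] := @EVT_min R G m d (ltW md).
  apply: (continuous_within_itvcc Im Id) => x Ix.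
  exact: is_derive_continuous (dG x Ix).
apply: (@lt_le_trans _ _ (G z * (d - m))).
  by rewrite mulr_gt0 ?subr_gt0// G_gt0//; exact: (itvcc_state_space Im Id).
apply: le_trans (Rintegral_itvcc_le Im Id avg_fin (fun x Ix => ltW (G_gt0 x Ix))).
apply: (Rintegral_itvcc_ge Im Id (ltW md)); first exact: (integrable_itvcc Im Id avg_fin).
by move=> t mt; exact: Gz.
Qed.
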